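(* As formal power series in $z$, $$\sum_{n\ge1}A^<_n(q,t)\frac{z^n}{[n]_q!}=\frac{(1-t)\frac{\partial}{\partial t}\sum_{i\ge2}[i]_t\frac{z^i}{[i]_q!}}{\exp_q(tz)-t\exp_q(z)}$$ and $$\sum_{n\ge1}\tilde A_n(q,t)\frac{z^n}{[n]_q!}=\frac{(1-t)\frac{\partial}{\partial t}\exp_q(tz)}{\exp_q(tz)-t\exp_q(z)}.$$
   Context: For $\sigma\in\mathfrak{S}_n$: $\mathrm{des}(\sigma):=|\{i\in\{1,\dots,n-1\}:\sigma(i)>\sigma(i+1)\}|$; $\mathrm{cdes}(\sigma):=|\{i\in\{1,\dots,n\}:\sigma(i)>\sigma(i+1)\}|$ with $\sigma(n+1):=\sigma(1)$; and $\mathrm{maj}_{\ge2}(\sigma):=\sum i$ over all $i\in\{1,\dots,n-1\}$ with $\sigma(i)-\sigma(i+1)\ge2$. Define $A^<_n(q,t):=\sum_{\sigma\in\mathfrak{S}_n,\,\sigma(1)<\sigma(n)}q^{\mathrm{maj}_{\ge2}(\sigma^{-1})}t^{\mathrm{des}(\sigma)}$ and $\tilde A_n(q,t):=\sum_{\sigma\in\mathfrak{S}_n}q^{\mathrm{maj}_{\ge2}(\sigma^{-1})}t^{\mathrm{cdes}(\sigma)}$. Also $[n]_t:=1+t+\cdots+t^{n-1}$, $[n]_q!:=[n]_q[n-1]_q\cdots[1]_q$, and $\exp_q(z):=\sum_{n\ge0}\frac{z^n}{[n]_q!}$. *)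

(* Defs.v *)
From HB Require Import structures.
From mathcomp Require Import all_boot all_order all_algebra all_fingroup.
From mathcomp Require Import boolp.

Set Implicit Arguments.
Unset Strict Implicit.
Unset Printing Implicit Defensive.

Import GRing.Theory.
Local Open Scope ring_scope.

Record fps (R : Type) := FPS { fcoef : nat -> R }.

Notation "{ 'fps' R }" := (fps R) (at level 0, format "{ 'fps'  R }") : type_scope.
Notation "\fps_ n E" := (FPS (fun n => E))
  (at level 36, n name, E at level 36, format "\fps_ n  E") : ring_scope.

Lemma fpsP (R : Type) (f g : {fps R}) :
  (forall n, fcoef f n = fcoef g n) <-> f = g.
Proof.
split=> [|-> //]; case: f g => [f] [g] /= fg.
by congr FPS; apply/funext.
Qed.

Definition fps_map (R S : Type) (h : R -> S) (f : {fps R}) : {fps S} :=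
  \fps_n h (fcoef f n).

HB.instance Definition _ (R : Type) := gen_eqMixin {fps R}.
HB.instance Definition _ (R : Type) := gen_choiceMixin {fps R}.

Section Zmodule.
Variable R : zmodType.
Implicit Types f g : {fps R}.

Definition fps_zero : {fps R} := \fps_n 0.
Definition fps_opp f : {fps R} := \fps_n - fcoef f n.
Definition fps_add f g : {fps R} := \fps_n (fcoef f n + fcoef g n).

Fact fps_addA : associative fps_add.
Proof. by move=> f g h; apply/fpsP=> n /=; rewrite addrA. Qed.
Fact fps_addC : commutative fps_add.
Proof. by move=> f g; apply/fpsP=> n /=; rewrite addrC. Qed.
Fact fps_add0 : left_id fps_zero fps_add.
Proof. by move=> f; apply/fpsP=> n /=; rewrite add0r. Qed.
Fact fps_addN : left_inverse fps_zero fps_opp fps_add.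
Proof. by move=> f; apply/fpsP=> n /=; rewrite addNr. Qed.

HB.instance Definition _ :=
  GRing.isZmodule.Build {fps R} fps_addA fps_addC fps_add0 fps_addN.
End Zmodule.

Section Ring.
Variable R : comNzRingType.
Implicit Types f g h : {fps R}.

Definition fps_const (c : R) : {fps R} := \fps_n (if n is 0 then c else 0).
Definition fps_mul f g : {fps R} :=
  \fps_n \sum_(i < n.+1) fcoef f i * fcoef g (n - i).

Let trunc N f : {poly R} := \poly_(i < N) fcoef f i.

Let fps_mul_trunc N f g n : (n < N)%N ->
  fcoef (fps_mul f g) n = (trunc N f * trunc N g)`_n.
Proof.
move=> ltnN; rewrite coefM /=; apply: eq_bigr => i _; rewrite !coef_poly.
have -> : (i < N)%N by apply: leq_trans (ltn_ord i) ltnN.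
by rewrite (leq_ltn_trans (leq_subr i n) ltnN).
Qed.

Fact fps_mulC : commutative fps_mul.
Proof.
by move=> f g; apply/fpsP=> n; rewrite !(@fps_mul_trunc n.+1) // mulrC.
Qed.

Fact fps_mulA : associative fps_mul.
Proof.
move=> f g h; apply/fpsP=> n.
transitivity (trunc n.+1 f * trunc n.+1 g * trunc n.+1 h)`_n.
  rewrite -mulrA coefM /=; apply: eq_bigr => i _.
  rewrite coef_poly ltn_ord -(@fps_mul_trunc n.+1) //.
  by rewrite ltnS leq_subr.
rewrite coefM; apply: eq_bigr => i _.
by rewrite coef_poly ltnS leq_subr -(@fps_mul_trunc n.+1) ?ltn_ord.
Qed.

Fact fps_mul1 : left_id (fps_const 1) fps_mul.
Proof.
move=> f; apply/fpsP=> n /=; rewrite big_ord_recl /= subn0 mul1r.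
by rewrite big1 ?addr0 // => i _; rewrite mul0r.
Qed.

Fact fps_mulDl : left_distributive fps_mul +%R.
Proof.
move=> f g h; apply/fpsP=> n /=; rewrite -big_split /=.
by apply: eq_bigr => i _; rewrite mulrDl.
Qed.

Fact fps_1neq0 : fps_const 1 != 0.
Proof.
by apply/eqP => /fpsP/(_ 0%N) /= /eqP; rewrite oner_eq0.
Qed.

HB.instance Definition _ := GRing.Zmodule_isComNzRing.Build {fps R}
  fps_mulA fps_mulC fps_mul1 fps_mulDl fps_1neq0.

Lemma coef_fpsM f g n :
  fcoef (f * g) n = \sum_(i < n.+1) fcoef f i * fcoef g (n - i).
Proof. by []. Qed.
End Ring.

Section UnitRing.
Variable R : comUnitRingType.
Implicit Types f g : {fps R}.

Definition fps_unit : {pred {fps R}} := fun f => fcoef f 0 \is a GRing.unit.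

(* The coefficients b_0, ..., b_n of 1 / f, obtained from
   a_0 b_0 = 1  and  a_0 b_n = - \sum_(i < n) a_(n - i) b_i. *)
Fixpoint fps_inv_seq f n : seq R :=
  if n is m.+1 then
    let s := fps_inv_seq f m in
    rcons s (- (fcoef f 0)^-1 * \sum_(i < n) fcoef f (n - i) * s`_i)
  else [:: (fcoef f 0)^-1].

Definition fps_inv f : {fps R} :=
  if f \in fps_unit then \fps_n (fps_inv_seq f n)`_n else f.

Let size_inv_seq f n : size (fps_inv_seq f n) = n.+1.
Proof. by elim: n => //= n IHn; rewrite size_rcons IHn. Qed.

Let nth_inv_seq f n i : (i <= n)%N ->
  (fps_inv_seq f n)`_i = (fps_inv_seq f i)`_i.
Proof.
elim: n => [|n IHn]; first by rewrite leqn0 => /eqP->.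
rewrite leq_eqVlt => /predU1P[-> //|lein].
by rewrite /= nth_rcons size_inv_seq lein IHn.
Qed.

Fact fps_mulVf : {in fps_unit, left_inverse 1 fps_inv *%R}.
Proof.
move=> f fU; apply/fpsP=> n; rewrite /fps_inv fU coef_fpsM /=.
case: n => [|n]; first by rewrite big_ord1 /= mulVr.
rewrite big_ord_recr /= nth_rcons size_inv_seq ltnn eqxx subnn.
rewrite mulrAC mulNr mulVr // mulN1r; apply/eqP; rewrite subr_eq0; apply/eqP.
apply: eq_bigr => i _.
by rewrite mulrC -(@nth_inv_seq f n i) // -ltnS ltn_ord.
Qed.

Fact fps_unitP f g : g * f = 1 -> f \in fps_unit.
Proof.
move=> /fpsP/(_ 0%N); rewrite coef_fpsM big_ord1 /= => gf1.
by apply/unitrP; exists (fcoef g 0); split; rewrite // mulrC.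
Qed.

Fact fps_inv_out : {in [predC fps_unit], fps_inv =1 id}.
Proof. by move=> f /negbTE fU; rewrite /fps_inv fU. Qed.

HB.instance Definition _ := GRing.ComNzRing_hasMulInverse.Build {fps R}
  fps_mulVf fps_unitP fps_inv_out.

Lemma fps_unitE f : (f \is a GRing.unit) = (fcoef f 0 \is a GRing.unit).
Proof. by []. Qed.
End UnitRing.

Section PermutationStatistics.
Variable n : nat.
Implicit Type s : 'S_n.

(* Positions and values are 0-based: i : 'I_n is position i + 1, and
   ordS i is the next position cyclically. *)
Definition des s : nat :=
  #|[set i : 'I_n | (i.+1 < n)%N && (s (ordS i) < s i)%N]|.

Definition cdes s : nat := #|[set i : 'I_n | (s (ordS i) < s i)%N]|.

Definition maj_ge2 s : nat :=
  (\sum_(i < n | (i.+1 < n) && (s (ordS i) + 2 <= s i)) i.+1)%N.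
End PermutationStatistics.

Definition Qq : fieldType := {fraction {poly rat}}.
Definition q : Qq := tofrac ('X : {poly rat}).

Definition Qqt : fieldType := {fraction {poly Qq}}.
Definition t : {poly Qq} := 'X.

Definition bracket (R : nzRingType) (n : nat) (x : R) : R :=
  \sum_(i < n) x ^+ i.

Definition qfact (n : nat) : Qq := \prod_(i < n) bracket i.+1 q.

Definition Alt (n : nat) : {poly Qq} :=
  if n is m.+1 then
    \sum_(s : 'S_m.+1 | (s ord0 < s ord_max)%N)
       q ^+ maj_ge2 s^-1%g *: t ^+ des s
  else 0.

Definition Atilde (n : nat) : {poly Qq} :=
  \sum_(s : 'S_n) q ^+ maj_ge2 s^-1%g *: t ^+ cdes s.

(* \sum_(n >= k) a n * z ^ n / [n]_q! *)
Definition qegf (k : nat) (a : nat -> {poly Qq}) : {fps {poly Qq}} :=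
  \fps_n (if (k <= n)%N then (qfact n)^-1 *: a n else 0).

Definition exp_q : {fps {poly Qq}} := qegf 0 (fun=> 1).

(* f(c z) *)
Definition fps_dilate (R : nzRingType) (c : R) (f : {fps R}) : {fps R} :=
  \fps_n (c ^+ n * fcoef f n).

(* The partial derivative with respect to t, coefficientwise in z. *)
Definition ddt (f : {fps {poly Qq}}) : {fps {poly Qq}} :=
  fps_map (@deriv Qq) f.

(* The embedding Q(q)[t][[z]] -> Q(q,t)[[z]]: the constant term 1 - t of
   exp_q(tz) - t exp_q(z) is invertible only in the latter ring. *)
Definition toQqt (f : {fps {poly Qq}}) : {fps Qqt} :=
  fps_map (@tofrac {poly Qq}) f.

(* Main.v *)
(* Attach to the permutation sigma the P-partitions f : [n] -> nat of the word
   sigma^-1, strict at the gaps counted by maj_ge2. Their generating function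
   is q^maj_ge2 / (q; q)_n, and for a fixed f the sum of t^des over the sigma
   compatible with f is a product of local weights along the path 1 - ... - n:
   1, 1 + t or t according as f_i >, = or < f_(i+1). (This is the
   specialization of the chromatic quasisymmetric function of the path.)
   With the side condition sigma(1) < sigma(n) one gets the same product
   restricted to f_1 >= f_n, minus t^(n-1) when f is constant.

   A local weight is t plus the weight v = [f_i >= f_(i+1)] - t [f_i > f_(i+1)].
   Expanding, a path becomes a sequence of independent monotone segments, so
   that F = V + t F V, where F and V are the series of paths and of segments,
   and V is known from the q-binomial theorem: Et (1 + (1 - t) V) = E with
   E = exp_q(z) and Et = exp_q(tz). For paths with f_1 < f_n the last and the
   first segments join into a single segment with one strict step; summing over
   the place of that step is -d/dt of V, whence the series
   t (-dV/dt) (1 + t F). The constant f contribute the logarithmic derivative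
   of Et. The first identity follows by algebra, and the second one because
   cdes - des is 1 if sigma(1) < sigma(n) and 0 otherwise. *)
Require Import Defs.
From mathcomp Require Import all_boot all_order all_algebra all_fingroup.
From mathcomp Require Import boolp zify ring.
Import GRing.Theory.
Local Open Scope ring_scope.

Set Implicit Arguments.
Unset Strict Implicit.
Unset Printing Implicit Defensive.

(** * Summation over functions on a finite set *)

Fixpoint subseqs (s : seq nat) : seq (seq nat) :=
  if s is x :: s' then subseqs s' ++ map (cons x) (subseqs s') else [:: [::]].

Lemma size_subseqs s u : u \in subseqs s -> (size u <= size s)%N.
Proof.
elim: s u => [|x s IHs] u /=; first by rewrite inE => /eqP->.
rewrite mem_cat => /orP[/IHs/leqW //|/mapP[v /IHs le_v ->]] //=.
Qed.

Lemma sub_subseqs s u : u \in subseqs s -> {subset u <= s}.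
Proof.
elim: s u => [|x s IHs] u /=; first by rewrite inE => /eqP->.
rewrite mem_cat => /orP[/IHs su y /su|/mapP[v /IHs sv ->] y] //.
  by rewrite inE orbC => ->.
by rewrite !inE => /orP[->//|/sv ->]; rewrite orbT.
Qed.

Lemma big_subseqs_cat (R : nmodType) s1 s2 (F : seq nat -> R) :
  \sum_(u <- subseqs (s1 ++ s2)) F u
    = \sum_(u1 <- subseqs s1) \sum_(u2 <- subseqs s2) F (u1 ++ u2).
Proof.
elim: s1 F => [|x s IHs] F /=; first by rewrite big_seq1.
by rewrite !big_cat !big_map /= !IHs.
Qed.

(** The full list is the only entry of maximal size. Its term is split off because it reproduces the
    unknown itself in the recursions below. *)
Lemma big_subseqs_full (R : nmodType) s (F : seq nat -> R) :
  \sum_(u <- subseqs s) F u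
    = F s + \sum_(u <- subseqs s | (size u < size s)%N) F u.
Proof.
elim: s F => [|x s IHs] F /=; first by rewrite big_seq1 big1_seq ?addr0 // => u /andP[].
rewrite !big_cat !big_map /= [X in _ + X]IHs addrCA; congr (_ + (_ + _)).
rewrite [LHS]big_seq [RHS]big_seq_cond; apply: eq_bigl => u.
by case us: (u \in _) => //=; rewrite ltnS size_subseqs.
Qed.

(** Swaps of adjacent blocks generate all rearrangements, and such a swap only exchanges two nested
    sums. *)
Lemma big_subseqs_perm (R : nmodType) s1 s2 (F : seq nat -> R) :
    (forall u v, perm_eq u v -> F u = F v) -> perm_eq s1 s2 ->
  \sum_(u <- subseqs s1) F u = \sum_(u <- subseqs s2) F u.
Proof.
move=> FP eq_s; pose P s := \sum_(u <- subseqs s1) F u = \sum_(u <- subseqs s) F u.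
apply: (@catCA_perm_ind _ P) eq_s _ => // a b c; rewrite /P => ->.
have swap s s' : \sum_(u <- subseqs s) \sum_(v <- subseqs s') \sum_(w <- subseqs c) F (u ++ v ++ w)
   = \sum_(u <- subseqs (s ++ s' ++ c)) F u.
  by rewrite big_subseqs_cat; apply: eq_bigr => u _; rewrite big_subseqs_cat.
rewrite -!swap exchange_big /=.
by do 3 (apply: eq_bigr => ? _); apply: FP; rewrite perm_catCA.
Qed.

(** Inverse of subtracting 1 on the support: a function on [s] amounts to its support [u] and a
    function on [u]. *)
Definition uplift (u : seq nat) (f : nat -> nat) : nat -> nat :=
  fun i => if i \in u then (f i).+1 else 0%N.

(** Such a [W] sees only the weak ordering that [f] induces on [s], so raising all of [s] by 1 does
    not change it. *)
Definition order_local (T : Type) (s : seq nat) (W : (nat -> nat) -> T) :=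
  forall f g, {in s &, forall i j, (f i <= f j)%N = (g i <= g j)%N} -> W f = W g.

Lemma order_local_uplift T s u (W : _ -> T) : {subset u <= s} ->
  order_local s W -> order_local u (W \o uplift u).
Proof.
move=> us Ws f g fg; apply: Ws => i j _ _; rewrite /uplift.
by case: ifP; case: ifP => // ju iu; rewrite !ltnS fg.
Qed.

Lemma order_local_uplift_id T s (W : _ -> T) : order_local s W -> W \o uplift s = W.
Proof.
by move=> Ws; apply/funext => f /=; apply: Ws => i j; rewrite /uplift => -> ->.
Qed.

Lemma order_localS T s s' (W : _ -> T) : {subset s <= s'} ->
  order_local s W -> order_local s' W.
Proof. by move=> ss' Ws f g fg; apply: Ws => i j /ss' si /ss'; apply: fg. Qed.

Lemma uplift_perm u v : perm_eq u v -> uplift u = uplift v.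
Proof. by move=> /perm_mem uv; apply/funext => f; apply/funext => i; rewrite /uplift uv. Qed.

(* qlam q s W stands for the infinite sum of q ^ |f| * W f over all f : s -> nat,
   for W order-local on s: splitting off the set u of positive entries of f and
   subtracting 1 there gives a recursion that makes sense in any ring where the
   1 - q ^ n are invertible. The first argument of qlam_rec is fuel. *)
Fixpoint qlam_rec (R : comUnitRingType) (q : R) n s (W : (nat -> nat) -> R) : R :=
  if n isn't n'.+1 then W (fun=> 0%N) else
  if s is [::] then W (fun=> 0%N) else
  (1 - q ^+ size s)^-1 *
    \sum_(u <- subseqs s | (size u < size s)%N)
       q ^+ size u * qlam_rec q n' u (W \o uplift u).

Definition qlam (R : comUnitRingType) (q : R) s (W : (nat -> nat) -> R) :=
  qlam_rec q (size s) s W.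

Section Lam.
Variables (R : comUnitRingType) (q : R).
Implicit Types (s u : seq nat) (W : (nat -> nat) -> R).
Local Notation lam := (qlam q).
Local Notation lam_rec := (qlam_rec q).

Lemma lam_nil W : lam [::] W = W (fun=> 0%N). Proof. by []. Qed.

Lemma lam_rec_fuel n s W : (size s <= n)%N -> lam_rec n s W = lam s W.
Proof.
rewrite /qlam; move: {2}(size s) (leqnn (size s)) => m.
move: n W s; elim: m => [|m IHm] [|n] W [|x s] //= le_sm le_sn.
congr (_ * _); apply: eq_bigr => u lt_us.
rewrite !ltnS in le_sm le_sn lt_us.
by rewrite !IHm ?(leq_trans lt_us).
Qed.

Lemma lamS s W : s != [::] ->
  lam s W = (1 - q ^+ size s)^-1 *
    \sum_(u <- subseqs s | (size u < size s)%N)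
       q ^+ size u * lam u (W \o uplift u).
Proof.
case: s => // x s _; rewrite {1}/qlam /=; congr (_ * _); apply: eq_bigr => u lt_us.
by rewrite lam_rec_fuel.
Qed.

Lemma lam_ind (P : seq nat -> Prop) :
  (forall s, (forall u, (size u < size s)%N -> P u) -> P s) -> forall s, P s.
Proof.
move=> IH s; move: {2}(size s).+1 (ltnSn (size s)) => n.
by elim: n s => // n IHn s lt_sn; apply: IH => u lt_us; apply: IHn; apply: leq_trans lt_us _.
Qed.

Lemma lamD s W1 W2 : lam s (fun f => W1 f + W2 f) = lam s W1 + lam s W2.
Proof.
elim/lam_ind: s W1 W2 => -[|x s] IHs W1 W2 //.
rewrite !lamS //. rewrite -[RHS]mulrDr -big_split; congr (_ * _); apply: eq_bigr => u /IHs IHu.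
by rewrite /= -mulrDr -IHu.
Qed.

Lemma lamZ s c W : lam s (fun f => c * W f) = c * lam s W.
Proof.
elim/lam_ind: s W => -[|x s] IHs W //.
rewrite !lamS // [RHS]mulrCA [c * _]mulr_sumr; congr (_ * _); apply: eq_bigr => u /IHs IHu.
by rewrite /= [RHS]mulrCA -IHu.
Qed.

Lemma lam0 s : lam s (fun=> 0) = 0.
Proof. by have := lamZ s 0 (fun=> 0); rewrite !mul0r. Qed.

Lemma lam_sum (I : Type) (r : seq I) (P : pred I) s (W : I -> (nat -> nat) -> R) :
  lam s (fun f => \sum_(i <- r | P i) W i f) = \sum_(i <- r | P i) lam s (W i).
Proof.
elim: r => [|i r IHr].
  by rewrite big_nil -[RHS](lam0 s); congr lam; apply/funext => f; rewrite big_nil.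
rewrite big_cons -IHr; case Pi: (P i).
  by rewrite -lamD; congr lam; apply/funext => f; rewrite big_cons Pi.
by congr lam; apply/funext => f; rewrite big_cons Pi.
Qed.

Lemma eq_lam s W1 W2 : W1 =1 W2 -> lam s W1 = lam s W2.
Proof. by move=> /funext->. Qed.

Lemma lam_perm s1 s2 W : perm_eq s1 s2 -> lam s1 W = lam s2 W.
Proof.
elim/lam_ind: s1 s2 W => s1 IHs s2 W eq_s.
have [s1_0|s1_neq0] := eqVneq s1 [::].
  by move: eq_s; rewrite s1_0 perm_sym => /perm_nilP->.
have s2_neq0 : s2 != [::] by apply: contraNneq s1_neq0 => s2_0; apply/eqP/perm_nilP; rewrite -s2_0.
rewrite !lamS // (perm_size eq_s); congr (_ * _).
rewrite big_mkcond [RHS]big_mkcond; apply: big_subseqs_perm => // u v uv.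
rewrite (perm_size uv) (uplift_perm uv); case: ifP => // lt_v; congr (_ * _).
by apply: IHs => //; rewrite (perm_size uv) (perm_size eq_s).
Qed.

Hypothesis qU : forall n, 1 - q ^+ n.+1 \is a GRing.unit.

(** Undoes the division in [lamS]: by order-locality the term [u = s] is [q ^+ size s * lam s W].
    The sum is thereby split according to the support of [f]. *)
Lemma lamE s W : order_local s W ->
  lam s W = \sum_(u <- subseqs s) q ^+ size u * lam u (W \o uplift u).
Proof.
move=> Ws; rewrite big_subseqs_full order_local_uplift_id //.
case: s Ws => [|x s] Ws; first by rewrite /= mul1r big1_seq ?addr0 // => u /andP[].
set S := \sum_(_ <- _ | _) _.
have LS : (1 - q ^+ size (x :: s)) * lam (x :: s) W = S.
  by rewrite lamS // mulrA mulrV ?mul1r //; apply: qU.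
by rewrite -LS; ring.
Qed.

(** Fubini's rule for the formal sum. A support in [s1 ++ s2] is a pair of supports; by induction
    all pairs but the full one agree, so both sides solve the same equation [x = q ^+ m.+1 * x + a],
    whose solution is unique. *)
Lemma lam_cat s1 s2 W1 W2 :
    {in s1, forall i, i \notin s2} -> order_local s1 W1 -> order_local s2 W2 ->
  lam (s1 ++ s2) (fun f => W1 f * W2 f) = lam s1 W1 * lam s2 W2.
Proof.
move: s1 s2 W1 W2; suff IH n s1 s2 W1 W2 : (size s1 + size s2 < n)%N ->
    {in s1, forall i, i \notin s2} -> order_local s1 W1 -> order_local s2 W2 ->
    lam (s1 ++ s2) (fun f => W1 f * W2 f) = lam s1 W1 * lam s2 W2.
  by move=> s1 s2 W1 W2; apply: (IH (size s1 + size s2).+1).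
elim: n s1 s2 W1 W2 => // n IHn s1 s2 W1 W2 lt_n dis W1s W2s.
have W12 : order_local (s1 ++ s2) (fun f => W1 f * W2 f).
  move=> f g fg; congr (_ * _); [apply: W1s | apply: W2s] => i j si sj;
  by apply: fg; rewrite mem_cat ?si ?sj ?orbT.
have [s12|] := eqVneq (s1 ++ s2) [::].
  by move: s12; case: s1 {dis W1s W12 lt_n} => //= ->; rewrite !lam_nil.
rewrite -size_eq0 size_cat; case Ds: (size s1 + size s2)%N => [//|m] _.
have full (x y a : R) : x = q ^+ m.+1 * x + a -> y = q ^+ m.+1 * y + a -> x = y.
  move=> xE yE; apply: (mulrI (qU m)); rewrite !mulrBl !mul1r.
  by rewrite {1}xE {1}yE; ring.
pose F u1 u2 := q ^+ (size u1 + size u2) *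
  (lam u1 (W1 \o uplift u1) * lam u2 (W2 \o uplift u2)).
apply: (full _ _ (\sum_(u1 <- subseqs s1) \sum_(u2 <- subseqs s2)
           (if (size u1 + size u2 < m.+1)%N then F u1 u2 else 0))).
  rewrite [LHS]lamE // big_subseqs_full size_cat Ds; congr (_ * _ + _).
    by rewrite order_local_uplift_id.
  rewrite big_mkcond big_subseqs_cat.
  rewrite big_seq [RHS]big_seq; apply: eq_bigr => u1 u1s.
  rewrite big_seq [RHS]big_seq; apply: eq_bigr => u2 u2s.
  rewrite size_cat; case: ifP => // lt_u; rewrite /F; congr (_ * _).
  have su1 := sub_subseqs u1s; have su2 := sub_subseqs u2s.
  rewrite -IHn; first 1 last.
  - by move: lt_n; rewrite Ds ltnS; apply: leq_trans.
  - by move=> i /su1 /dis; apply: contra => /su2.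
  - exact: order_local_uplift su1 W1s.
  - exact: order_local_uplift su2 W2s.
  apply: eq_lam => f /=; congr (_ * _).
    apply: W1s => i j /dis i2 /dis j2; rewrite /uplift !mem_cat.
    have /negbTE-> : i \notin u2 by apply: contra i2 => /su2.
    have /negbTE-> : j \notin u2 by apply: contra j2 => /su2.
    by rewrite !orbF.
  have nu1 k : k \in s2 -> (k \in u1) = false.
    by move=> ks; apply/negP => /su1 /dis; rewrite ks.
  by apply: W2s => i j /nu1 i2 /nu1 j2; rewrite /uplift !mem_cat i2 j2.
rewrite {1}lamE // {1}(@lamE s2) // mulr_suml.
under eq_bigr => u1 _ do rewrite mulr_sumr.
have -> : q ^+ m.+1 * (lam s1 W1 * lam s2 W2) = F s1 s2.
  by rewrite /F !order_local_uplift_id // Ds.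
transitivity (\sum_(u1 <- subseqs s1) \sum_(u2 <- subseqs s2) F u1 u2).
  by do 2 (apply: eq_bigr => ? _); rewrite /F exprD; ring.
rewrite !big_subseqs_full Ds ltnn add0r -addrA; congr (_ + (_ + _)).
  rewrite big_seq_cond [RHS]big_seq_cond; apply: eq_bigr => u2 /andP[_ lt_u2].
  by rewrite -Ds ltn_add2l lt_u2.
apply: eq_bigr => u1 lt_u1; rewrite big_seq [RHS]big_seq; apply: eq_bigr => u2 /size_subseqs le_u2.
by rewrite -Ds -addSn leq_add.
Qed.
End Lam.

(** * Chains *)

Definition qpoch (R : nzRingType) (q : R) n : R := \prod_(i < n) (1 - q ^+ i.+1).

Lemma qpochS (R : nzRingType) (q : R) n : qpoch q n.+1 = qpoch q n * (1 - q ^+ n.+1).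
Proof. by rewrite /qpoch big_ord_recr. Qed.

Section OrderLocal.
Variables (T1 T2 T : Type) (s : seq nat).

Lemma order_local_app (op : T1 -> T) W : order_local s W -> order_local s (fun f => op (W f)).
Proof. by move=> Ws f g fg; rewrite (Ws _ _ fg). Qed.

Lemma order_local_op (op : T1 -> T2 -> T) W1 W2 :
  order_local s W1 -> order_local s W2 -> order_local s (fun f => op (W1 f) (W2 f)).
Proof. by move=> W1s W2s f g fg; rewrite (W1s _ _ fg) (W2s _ _ fg). Qed.

Lemma order_local_le x y : x \in s -> y \in s ->
  order_local s (fun f => f x <= f y)%N.
Proof. by move=> sx sy f g fg; rewrite fg. Qed.

Lemma order_local_lt x y : x \in s -> y \in s ->
  order_local s (fun f => f x < f y)%N.
Proof. by move=> sx sy f g fg; rewrite !ltnNge fg. Qed.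
End OrderLocal.

Section Chain.
Variables (R : comUnitRingType) (q : R) (a b : nat -> nat -> R).
Hypothesis qU : forall n, 1 - q ^+ n.+1 \is a GRing.unit.
Implicit Types (s u : seq nat) (f : nat -> nat).

(** The coefficient pairs (1, 0), (0, 1) and (1, -1) give a weak step, a strict step and an
    equality. *)
Definition edge_weight f x y : R := a x y *+ (f x <= f y)%N + b x y *+ (f x < f y)%N.

Fixpoint chain_weight s f : R :=
  if s is x :: s' then
    (if s' is y :: _ then edge_weight f x y else 1) * chain_weight s' f
  else 1.

(** A strict step is a weak one after raising all later letters by 1, which costs [q ^+ size s']. *)
Fixpoint chain_value s : R :=
  if s is x :: s' then
    (if s' is y :: _ then a x y + b x y * q ^+ size s' else 1) * chain_value s'
  else 1.

Lemma order_local_edge s x y : x \in s -> y \in s ->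
  order_local s (fun f => edge_weight f x y).
Proof.
move=> sx sy; apply: order_local_op; apply: order_local_app.
  by apply: order_local_app; apply: order_local_le.
by apply: order_local_app; apply: order_local_lt.
Qed.

Lemma order_local_chain s : order_local s (chain_weight s).
Proof.
elim: s => [|x [|y s] IHs] //=.
apply: order_local_op; first by apply: order_local_edge; rewrite !inE eqxx ?orbT.
by apply: order_localS IHs => z zs; rewrite inE zs orbT.
Qed.

Lemma chain_weight_eq0 x s f z : z \in s -> (f z < f x)%N -> chain_weight (x :: s) f = 0.
Proof.
elim: s x => // y s IHs x; rewrite [chain_weight _ _]/= -/(chain_weight (y :: s) f).
have [lt_yx|le_xy] := ltnP (f y) (f x).
  by rewrite /edge_weight (leqNgt (f x)) lt_yx (ltnNge (f x)) (ltnW lt_yx) /= !mulr0n addr0 mul0r.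
rewrite inE => /predU1P[->|sz lt_z]; first by rewrite ltnNge le_xy.
by rewrite (IHs y) ?mulr0 // (leq_trans lt_z).
Qed.

Lemma subseqs_missing s u : uniq s -> u \in subseqs s -> (size u < size s)%N ->
  exists2 z, z \in s & z \notin u.
Proof.
move=> us su lt_us; apply/hasP; apply: contraLR lt_us; rewrite -leqNgt => /hasPn su'.
by apply: uniq_leq_size => // z /su'; rewrite negbK.
Qed.

Lemma lam_chain s : uniq s ->
  qlam q s (chain_weight s) = (qpoch q (size s))^-1 * chain_value s.
Proof.
elim: s => [_|x s IHs]; first by rewrite /qpoch big_ord0 invr1 mulr1 lam_nil.
move=> us'; have /andP[xs us] : (x \notin s) && uniq s by [].
set C := chain_weight (x :: s).
have C_ol : order_local (x :: s) C by exact: order_local_chain.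
set c := if s is y :: _ then a x y + b x y * q ^+ size s else 1.
suff step : qlam q (x :: s) C = c * qlam q s (chain_weight s) + q ^+ (size s).+1 * qlam q (x :: s) C.
  apply: (mulrI (qU (size s))); rewrite mulrBl mul1r {1}step addrK.
  rewrite (IHs us) qpochS invrM //; last by rewrite rpred_prod.
  rewrite /= -/c; have := mulrV (qU (size s)).
  by move=> E; rewrite !mulrA E mul1r; ring.
have Cs : order_local s (chain_weight s) by exact: order_local_chain.
rewrite {1}lamE // [subseqs _]/= big_cat big_map /=; congr (_ + _); last first.
  (* Supports containing [x]: a letter outside would have value 0, below that of [x], so only the
     full support survives. *)
  rewrite big_subseqs_full order_local_uplift_id // [X in _ + X]big1_seq ?addr0 // => u /andP[lt_us su].
  have [z sz uz] := subseqs_missing us su lt_us.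
  have zx : z != x by apply: contraNneq xs => <-.
  rewrite [X in _ * X](_ : _ = 0) ?mulr0 // -[RHS](lam0 q (x :: u)); apply: eq_lam => f /=.
  by apply: (@chain_weight_eq0 _ _ _ z) => //; rewrite /uplift !inE eqxx (negbTE zx) (negbTE uz).
(* As [x] now has value 0, the weak part of the first edge always holds and the strict part tests
   [0 < f y]. *)
have Cx u : u \in subseqs s -> qlam q u (C \o uplift u) =
    (if s is y :: _ then a x y else 1) * qlam q u (chain_weight s \o uplift u) +
    (if s is y :: _ then b x y else 0) *
      qlam q u ((fun f => (if s is y :: _ then (0 < f y)%N%:R else 0) * chain_weight s f) \o uplift u).
  move=> /sub_subseqs su; have xu : x \notin u by apply: contra xs => /su.
  rewrite -!lamZ -lamD; apply: eq_lam => f /=; rewrite /C /=.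
  case: (s) => [|y s']; first by ring.
  rewrite /edge_weight (_ : uplift u f x = 0%N) ?leq0n; last by rewrite /uplift (negbTE xu).
  by rewrite mulr1n; case: (0 < _)%N; rewrite ?mulr1n ?mulr0n; ring.
under eq_big_seq => u su do rewrite Cx // mulrDr mulrCA [X in _ + X]mulrCA.
rewrite big_split /= -!mulr_sumr -lamE //.
(* The strict part puts [y] into the support, and with it all of [s], as the chain increases from
   [y] on. *)
rewrite big_subseqs_full [X in _ + _ * (_ + X)]big1_seq ?addr0 => [|u /andP[lt_us su]].
  rewrite {}/c; case: (s) Cs => [|y s'] Cs; first by rewrite mul0r addr0.
  rewrite mulrDl -[X in _ = _ + X]mulrA; congr (_ + _ * (_ * _)); apply: eq_lam => f.
  rewrite -[in RHS](order_local_uplift_id Cs) /= {1}/uplift inE eqxx mul1r //.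
have [z sz uz] := subseqs_missing us su lt_us.
rewrite [X in _ * X](_ : _ = 0) ?mulr0 // -[RHS](lam0 q u); apply: eq_lam => f /=.
case: (s) sz => [|y s'] //; rewrite inE => sz; rewrite {1}/uplift.
have [yu|_] := boolP (y \in u); last by rewrite mul0r.
have zy : z != y by apply: contraNneq uz => ->.
rewrite (negbTE zy) /= in sz.
rewrite mul1r; apply: (@chain_weight_eq0 _ _ _ z) => //.
by rewrite /uplift yu (negbTE uz).
Qed.
End Chain.

(** * Words compatible with a function *)

Definition insert_at (x i : nat) (s : seq nat) := take i s ++ x :: drop i s.

Fixpoint perm_words n : seq (seq nat) :=
  if n is m.+1 then [seq insert_at m i s | s <- perm_words m, i <- iota 0 m.+1]
  else [:: [::]].

Lemma index_insert_at x i s : x \notin s -> (i <= size s)%N -> index x (insert_at x i s) = i.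
Proof.
move=> xs le_i; rewrite /insert_at index_cat ifN ?(contra (@mem_take _ _ _ _)) //.
by rewrite /= eqxx addn0 size_takel.
Qed.

Lemma index_insert_at_neq x i s y : y != x -> y \in s ->
  index y (insert_at x i s) = (index y s + (i <= index y s))%N.
Proof.
move=> yx ys; rewrite /insert_at index_cat /=  [x == y]eq_sym (negbTE yx).
have [le_si|lt_is] := leqP (size s) i.
  have lt_y : (index y s < size s)%N by rewrite index_mem.
  by rewrite take_oversize // ys leqNgt (leq_trans lt_y) ?addn0.
have -> : index y s = if y \in take i s then index y (take i s) else (i + index y (drop i s))%N.
  by rewrite -[in LHS](cat_take_drop i s) index_cat size_takel // ltnW.
case: ifP => yt; last by rewrite leq_addr size_takel ?addn1 ?addnS // ltnW.
move: yt; rewrite -index_mem size_takel; last exact: ltnW.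
by move=> lt_y; rewrite leqNgt lt_y addn0.
Qed.

Lemma perm_insert_at x i s : perm_eq (insert_at x i s) (x :: s).
Proof. by rewrite /insert_at -cat1s perm_catCA /= perm_cons cat_take_drop. Qed.

Lemma rem_insert_at x i s : x \notin s -> rem x (insert_at x i s) = s.
Proof.
move=> xs; rewrite remE /insert_at.
have xt : x \notin take i s by apply: contra xs; apply: mem_take.
rewrite index_cat (negbTE xt) /= eqxx addn0 take_size_cat // drop_cat.
by rewrite ltnNge leqnSn subSn // subnn /= drop0 cat_take_drop.
Qed.

Lemma insert_at_rem x s : x \in s -> insert_at x (index x s) (rem x s) = s.
Proof.
move=> xs; rewrite remE /insert_at.
have le_i : (index x s <= size s)%N by exact: index_size.
rewrite take_cat drop_cat size_takel // ltnn subnn take0 drop0 cats0.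
rewrite -[RHS](cat_take_drop (index x s)); congr (_ ++ _).
by rewrite [RHS](drop_nth x) ?index_mem // nth_index.
Qed.

Lemma mem_perm_words n s : (s \in perm_words n) = perm_eq s (iota 0 n).
Proof.
have iotaS m : perm_eq (m :: iota 0 m) (iota 0 m.+1).
  by rewrite -addn1 iotaD perm_sym cats1 perm_rcons.
elim: n s => [|n IHn] s; first by rewrite inE; apply/eqP/idP => [->//|/perm_nilP].
apply/allpairsP/idP => [[[u i] /= [us _ ->]]|sP].
  by rewrite IHn in us; apply: perm_trans (perm_insert_at _ _ _) _; rewrite -(permPr (iotaS n)) perm_cons.
have ns : n \in s by rewrite (perm_mem sP) mem_iota /=.
exists (rem n s, index n s); split; last by rewrite insert_at_rem.
  rewrite IHn -(perm_cons n); apply: perm_trans (_ : perm_eq _ s) _.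
    by rewrite perm_sym perm_to_rem.
  by rewrite perm_sym (perm_trans (iotaS n)) // perm_sym.
by rewrite mem_iota /= add0n -(size_iota 0 n.+1) -(perm_size sP) index_mem.
Qed.

Lemma perm_words_uniq n : uniq (perm_words n).
Proof.
elim: n => // n IHn; apply: allpairs_uniq => //; first exact: iota_uniq.
move=> _ _ /allpairsP[[u' i'] [uP iP ->]] /allpairsP[[v' j'] [vP jP ->]].
rewrite ![_.1]/= ![_.2]/= in uP iP vP jP *; move=> eq_uv'.
have eq_uv : insert_at n i' u' = insert_at n j' v' := eq_uv'.
have nout w : w \in perm_words n -> n \notin w.
  by rewrite mem_perm_words => /perm_mem->; rewrite mem_iota /= add0n ltnn.
have szw w : w \in perm_words n -> size w = n.
  by rewrite mem_perm_words => /perm_size->; rewrite size_iota.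
have eq_u : u' = v' by rewrite -(rem_insert_at i' (nout _ uP)) eq_uv rem_insert_at ?nout.
rewrite !mem_iota /= !add0n !ltnS in iP jP.
congr pair => //; rewrite -(@index_insert_at n i' u') ?nout ?szw //.
by rewrite eq_uv index_insert_at ?nout ?szw.
Qed.

(* The P-partition condition, for the word s read from the largest value of the
   permutation down: f increases weakly along s, and strictly at each pair that
   contributes to maj_ge2. *)
Definition compat (f : nat -> nat) (s : seq nat) :=
  sorted (fun x y => f x + (x + 2 <= y) <= f y)%N s.

Section Insertion.
Variables (f : nat -> nat) (n : nat) (s : seq nat).
Hypothesis sP : perm_eq s (iota 0 n.+1).
Let N := n.+1.
Let j := find (fun x => f N <= f x)%N s.
Let p := index n s.

Let ns : n \in s. Proof. by rewrite (perm_mem sP) mem_iota /=. Qed.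
Let sz : size s = n.+1. Proof. by rewrite (perm_size sP) size_iota. Qed.
Let lt_p : (p < n.+1)%N. Proof. by rewrite -sz index_mem. Qed.
Let Ns : N \notin s. Proof. by rewrite (perm_mem sP) mem_iota /= ltnn. Qed.
Let us : uniq s. Proof. by rewrite (perm_uniq sP) iota_uniq. Qed.

Lemma compat_nth s' : compat f s' <->
  (forall i, (i.+1 < size s')%N ->
    (f (nth 0 s' i) + (nth 0 s' i + 2 <= nth 0 s' i.+1) <= f (nth 0 s' i.+1))%N).
Proof. by split=> [/sortedP|H]; [apply | apply/(sortedP 0%N)]. Qed.

Lemma compat_mono : compat f s -> forall i k, (i <= k < n.+1)%N ->
  (f (nth 0 s i) <= f (nth 0 s k))%N.
Proof.
move=> /compat_nth C i k /andP[le_ik lt_k]; elim: k le_ik lt_k => [|k IHk].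
  by rewrite leqn0 => /eqP->.
rewrite leq_eqVlt => /predU1P[-> //|le_ik] lt_k.
apply: leq_trans (IHk le_ik (ltnW lt_k)) _.
by have := C k; rewrite sz => /(_ lt_k); apply: leq_trans; rewrite leq_addr.
Qed.

Let nth_lt i : (i < n.+1)%N -> (nth 0 s i < N)%N.
Proof. by move=> lt_i; have := mem_nth 0%N (_ : i < size s)%N; rewrite sz (perm_mem sP) mem_iota /= add0n; apply. Qed.

(** Values increase weakly along a compatible word, so the letters with value at least [f N] form a
    final segment. *)
Let j_le i : compat f s -> (i < n.+1)%N -> (f N <= f (nth 0 s i))%N = (j <= i)%N.
Proof.
move=> C lt_i; apply/idP/idP => [le_f|le_j].
  by rewrite leqNgt; apply/negP => /(before_find 0%N); rewrite le_f.
have lt_j : (j < n.+1)%N by apply: leq_ltn_trans lt_i.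
apply: leq_trans (compat_mono C (_ : j <= i < n.+1)%N); last by rewrite le_j lt_i.
by apply: (@nth_find _ 0%N (fun x => f N <= f x)%N); rewrite has_find sz.
Qed.

(* The letter n + 1 can always go just before the first letter whose value is at
   least f (n + 1); since n + 1 and n may share a value in either order, it can
   also go right after n when f (n + 1) = f n. *)
Lemma compat_insert_at i : (i <= n.+1)%N ->
  compat f (insert_at N i s) =
    compat f s && ((i == j) || ((i == p.+1) && (f N == f n))).
Proof.
move=> le_i.
have nthI_lt k : (k < i)%N -> nth 0%N (insert_at N i s) k = nth 0%N s k.
  by move=> lt_k; rewrite /insert_at nth_cat size_takel ?sz // lt_k nth_take.
have nthI_eq k : k = i -> nth 0%N (insert_at N i s) k = N.
  by move=> ->; rewrite /insert_at nth_cat size_takel ?sz // ltnn subnn.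
have nthI_gt k : (i <= k)%N -> nth 0%N (insert_at N i s) k.+1 = nth 0%N s k.
  move=> le_k; rewrite /insert_at nth_cat size_takel ?sz // ltnNge leqW //=.
  by rewrite subSn //= nth_drop subnKC.
have szI : size (insert_at N i s) = n.+2.
  by rewrite (perm_size (perm_insert_at _ _ _)) /= sz.
have nth_p k : (k < n.+1)%N -> (nth 0%N s k == n) = (k == p).
  by move=> lt_k; rewrite -(nth_index 0%N ns) nth_uniq // ?sz.
have CI : compat f (insert_at N i s) -> compat f s.
  move=> /compat_nth C; apply/compat_nth => k; rewrite sz => lt_k.
  have [lt_ki|gt_ki|eq_ki] := ltngtP k.+1 i.
  - have := C k; rewrite szI !nthI_lt ?(ltn_trans (ltnSn k) lt_ki) //.
    by apply; rewrite ltnW.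
  - have := C k.+1; rewrite szI (nthI_gt k) // (nthI_gt k.+1); last exact: ltnW.
    by apply.
  - have := C k; have := C k.+1; rewrite szI (nthI_eq k.+1) // (nthI_gt k.+1) ?eq_ki // nthI_lt -?eq_ki //.
    move=> /(_ lt_k) H2 /(_ (ltnW lt_k)) H1.
    have := nth_lt lt_k; have := nth_lt (ltnW lt_k); rewrite /N in H1 H2 *; lia.
apply/idP/andP => [C|[C ij]].
  have Cs := CI C; split=> //; move/compat_nth: C => C.
  have le_ji : (j <= i)%N.
    have [->|neq_in] := eqVneq i n.+1; first by rewrite -sz find_size.
    have lt_i : (i < n.+1)%N by rewrite ltn_neqAle neq_in.
    rewrite -j_le //; have := C i; rewrite szI (nthI_eq i) // nthI_gt // => /(_ lt_i).
    by apply: leq_trans; rewrite leq_addr.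
  have [->|neq_ij] := eqVneq i j; first by [].
  have lt_ji : (j < i)%N by rewrite ltn_neqAle eq_sym neq_ij.
  have [k Di] : exists k, i = k.+1 by exists i.-1; rewrite (ltn_predK lt_ji).
  have lt_k : (k < n.+1)%N by rewrite -Di.
  have le_f : (f N <= f (nth 0%N s k))%N by rewrite j_le // -ltnS -Di.
  have := C k; rewrite szI (nthI_eq k.+1) // nthI_lt; last by rewrite Di.
  move=> /(_ lt_k) Ci.
  have lt_N := nth_lt lt_k.
  have eq_n : nth 0%N s k = n by move: lt_N Ci le_f; rewrite /N; lia.
  move: (nth_p _ lt_k); rewrite eq_n eqxx => /esym/eqP <-; rewrite Di eqxx /=.
  by move: Ci le_f; rewrite eq_n; lia.
apply/compat_nth => k; rewrite szI ltnS => lt_k.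
have le_ji : (j <= i)%N.
  case/orP: ij => [/eqP-> //|/andP[/eqP-> /eqP eq_f]]; rewrite leqW //.
  by rewrite -j_le // nth_index // eq_f.
have [lt_ki|gt_ki|eq_ki] := ltngtP k.+1 i.
- rewrite !nthI_lt ?(ltn_trans (ltnSn k) lt_ki) //.
  by move/compat_nth: C; apply; rewrite sz; lia.
- case: k gt_ki lt_k => [|k]; rewrite ltnS => le_ik lt_k.
    move: le_ik le_ji; rewrite leqn0 => /eqP i0; rewrite i0 leqn0 => /eqP j0.
    have := nthI_gt 0%N; rewrite i0 => -> //; have := nthI_eq 0%N; rewrite i0 => -> //.
    have := nth_lt (ltn0Sn n) => lt_0.
    have : (f N <= f (nth 0 s 0))%N by rewrite j_le ?j0.
    by rewrite /N; lia.
  have [eq_ik|neq_ik] := eqVneq i k.+1.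
    rewrite (nthI_eq k.+1) // (nthI_gt k.+1) ?eq_ik //; rewrite eq_ik in le_ji *.
    have := nth_lt lt_k => lt_0.
    have : (f N <= f (nth 0 s k.+1))%N by rewrite j_le.
    by rewrite /N in lt_0 *; lia.
  rewrite !nthI_gt //; last by lia.
  by move/compat_nth: C; apply; rewrite sz.
- have lt_kn : (k < n.+1)%N by rewrite eq_ki.
  rewrite (nthI_eq k.+1) // nthI_lt; last by rewrite -eq_ki.
  case/orP: ij => [/eqP eq_ij|/andP[/eqP eq_ip /eqP eq_f]].
    have : ~~ (f N <= f (nth 0 s k))%N by rewrite j_le // -ltnNge -eq_ij -eq_ki.
    by lia.
  have -> : nth 0%N s k = n by move: eq_ki; rewrite eq_ip => -[->]; rewrite nth_index.
  by rewrite eq_f /N; lia.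
Qed.
End Insertion.

Lemma sum_insert_at (R : nmodType) (f : nat -> nat) n s (G : nat -> R) :
    perm_eq s (iota 0 n.+1) ->
  \sum_(i <- iota 0 n.+2 | compat f (insert_at n.+1 i s)) G i =
  if compat f s then
    G (find (fun x => f n.+1 <= f x)%N s)
      + (if f n.+1 == f n then G (index n s).+1 else 0)
  else 0.
Proof.
move=> sP; set j := find _ s; set p := index n s.
have sz : size s = n.+1 by rewrite (perm_size sP) size_iota.
have ns : n \in s by rewrite (perm_mem sP) mem_iota /=.
rewrite big_seq_cond.
under eq_bigl => i.
  rewrite (_ : _ && _ = (i \in iota 0 n.+2) && (compat f s &&
     ((i == j) || ((i == p.+1) && (f n.+1 == f n))))); last first.
    by rewrite mem_iota add0n leq0n; case: ltnP => //= le_i; rewrite compat_insert_at.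
  over.
rewrite -big_seq_cond; case: ifP => _ /=; last by rewrite big_pred0.
(* The two places are distinct: in case of a tie [n] itself passes the test, so [j <= p]. *)
have ineq : f n.+1 == f n -> (j <= p)%N.
  move=> /eqP eq_f; rewrite leqNgt; apply/negP => /(before_find 0%N).
  by rewrite nth_index // eq_f leqnn.
have jin : j \in iota 0 n.+2 by rewrite mem_iota add0n ltnS -sz find_size.
have pin : p.+1 \in iota 0 n.+2 by rewrite mem_iota add0n /= ltnS -sz index_mem.
rewrite big_mkcond (eq_bigr (fun i => (if i == j then G i else 0) +
   (if i == p.+1 then if f n.+1 == f n then G i else 0 else 0))).
  have pick a F : a \in iota 0 n.+2 -> \sum_(i <- iota 0 n.+2) (if i == a then F i else 0) = F a :> R.
    move=> ain; rewrite (bigD1_seq a) ?iota_uniq //= eqxx big1 ?addr0 // => i /negbTE-> //.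
  by rewrite big_split /= !pick.
move=> i _; case: (f _ == _) ineq => [/(_ isT)|_]; last first.
  by rewrite andbF orbF if_same addr0.
rewrite andbT => le_jp; have [->|] := eqVneq i j; last by rewrite add0r.
by rewrite ltn_eqF ?ltnS //= addr0.
Qed.

Section PathWeight.
Variables (R : comNzRingType) (t : R).
Implicit Types (f : nat -> nat) (s : seq nat).

(** The word of a permutation lists positions from the largest value down, so [k] precedes [k.+1]
    exactly at a descent. *)
Definition tdes m s : R :=
  \prod_(k < m) (if (index (k : nat) s < index k.+1 s)%N then t else 1).

Definition path_weight (e : nat -> nat -> R) i m f : R :=
  \prod_(k < m) e (f (i + k)%N) (f (i + k).+1).

(* A tie may be broken either way, hence its weight 1 + t. *)
Definition free_edge a b : R := (b <= a)%N%:R + t * (a <= b)%N%:R.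

Lemma path_weightS e i m f :
  path_weight e i m.+1 f = path_weight e i m f * e (f (i + m)%N) (f (i + m).+1).
Proof. by rewrite /path_weight big_ord_recr. Qed.

Lemma path_weight0 e i f : path_weight e i 0 f = 1.
Proof. by rewrite /path_weight big_ord0. Qed.

Lemma tdesS m s :
  tdes m.+1 s = tdes m s * (if (index m s < index m.+1 s)%N then t else 1).
Proof. by rewrite /tdes big_ord_recr. Qed.

Lemma tdes_insert_at n s i : perm_eq s (iota 0 n.+1) -> (i <= n.+1)%N ->
  tdes n.+1 (insert_at n.+1 i s) = tdes n s * (if (index n s < i)%N then t else 1).
Proof.
move=> sP le_i; have sz : size s = n.+1 by rewrite (perm_size sP) size_iota.
have ks k : (k <= n)%N -> k \in s by rewrite (perm_mem sP) mem_iota /= add0n ltnS.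
have Ns : n.+1 \notin s by rewrite (perm_mem sP) mem_iota /= add0n ltnn.
have idx k : (k <= n)%N -> index k (insert_at n.+1 i s) = (index k s + (i <= index k s))%N.
  by move=> le_k; rewrite index_insert_at_neq ?ks // ltn_eqF.
rewrite tdesS; congr (_ * _).
  apply: eq_bigr => k _; have lt_k := ltn_ord k.
  rewrite (idx k (ltnW lt_k)) (idx k.+1 lt_k); congr (if _ then _ else _).
  have [] := leqP i (index (k : nat) s); have [] := leqP i (index k.+1 s);
  rewrite ?addn1 ?addn0 ?ltnS //; lia.
rewrite index_insert_at ?sz // idx //; congr (if _ then _ else _).
by have [] := leqP i (index n s); lia.
Qed.

Lemma big_perm_words n (P : pred (seq nat)) (F : seq nat -> R) :
  \sum_(s <- perm_words n.+2 | P s) F s =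
  \sum_(s <- perm_words n.+1) \sum_(i <- iota 0 n.+2 | P (insert_at n.+1 i s))
    F (insert_at n.+1 i s).
Proof.
rewrite big_mkcond.
rewrite (_ : perm_words n.+2 = [seq insert_at n.+1 i s | s <- perm_words n.+1, i <- iota 0 n.+2]) //.
rewrite big_allpairs_dep.
by apply: eq_bigr => s _; rewrite [RHS]big_mkcond.
Qed.

Lemma compat_find n f s x : perm_eq s (iota 0 n.+1) -> compat f s -> (x <= n)%N ->
  (find (fun x => f n.+1 <= f x)%N s <= index x s)%N = (f n.+1 <= f x)%N.
Proof.
move=> sP C le_x.
have xs : x \in s by rewrite (perm_mem sP) mem_iota /= add0n ltnS.
have lt_x : (index x s < n.+1)%N by rewrite -(size_iota 0 n.+1) -(perm_size sP) index_mem.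
apply/idP/idP => [le_j|le_f].
  have := compat_mono sP C (_ : (find (fun x => f n.+1 <= f x)%N s <= index x s < n.+1)%N).
  rewrite le_j lt_x nth_index // => /(_ isT); apply: leq_trans.
  apply: (@nth_find _ 0%N (fun x => f n.+1 <= f x)%N).
  by rewrite has_find (perm_size sP) size_iota (leq_ltn_trans le_j).
rewrite leqNgt; apply/negP => /(before_find 0%N).
by rewrite nth_index // le_f.
Qed.

(** Inserting [n.+1] at its canonical place puts it after [n] iff [f n < f n.+1], hence a factor [t]
    or 1. A tie adds the place right after [n], with factor [t]. *)
Lemma sum_tdes n f :
  \sum_(s <- perm_words n.+1 | compat f s) tdes n s = path_weight free_edge 0 n f.
Proof.
elim: n => [|n IHn]; first by rewrite /= big_mkcond big_seq1 /= /tdes path_weight0 big_ord0.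
rewrite big_perm_words path_weightS -IHn [in RHS]big_mkcond mulr_suml.
rewrite big_seq [RHS]big_seq; apply: eq_bigr => s; rewrite mem_perm_words => sP.
have sz : size s = n.+1 by rewrite (perm_size sP) size_iota.
have ns : n \in s by rewrite (perm_mem sP) mem_iota /=.
rewrite (sum_insert_at f (fun i => tdes n.+1 (insert_at n.+1 i s))) //.
case: ifP => C; last by rewrite mul0r.
have le_j : (find (fun x => f n.+1 <= f x) s <= n.+1)%N by rewrite -sz find_size.
have le_p : (index n s < n.+1)%N by rewrite -sz index_mem.
rewrite !tdes_insert_at // ltnSn add0n (ltnNge (index n s)) compat_find // -ltnNge /free_edge.
by case: ltngtP => _; rewrite /=; ring.
Qed.

(* The corrective term is the identity word, the only compatible word of
   a constant f that fails the constraint while f n <= f 0. *)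
Lemma sum_tdes_lt n f :
  \sum_(s <- perm_words n.+1 | compat f s && (index n s < index 0%N s)%N) tdes n s =
  (f n <= f 0)%N%:R * path_weight free_edge 0 n f
   - t ^+ n * path_weight (fun a b => (a == b)%:R) 0 n f.
Proof.
elim: n => [|n IHn].
  by rewrite /= big_mkcond big_seq1 /= !path_weight0 leqnn mulr1 subrr.
rewrite big_perm_words !path_weightS exprS.
(* The canonical place of [n.+1] lies before the letter 0 iff [f n.+1 <= f 0]; the place right after
   [n] does iff [n] precedes 0. *)
transitivity (\sum_(s <- perm_words n.+1 | compat f s)
    ((f n.+1 <= f 0)%N%:R * (if (f n < f n.+1)%N then t else 1) * tdes n s
     + (f n.+1 == f n)%:R * t * (if (index n s < index 0%N s)%N then tdes n s else 0))).
  rewrite [RHS]big_mkcond big_seq [RHS]big_seq; apply: eq_bigr => s; rewrite mem_perm_words => sP.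
  have sz : size s = n.+1 by rewrite (perm_size sP) size_iota.
  have ns : n \in s by rewrite (perm_mem sP) mem_iota /=.
  have s0 : 0%N \in s by rewrite (perm_mem sP) mem_iota /=.
  have Ns : n.+1 \notin s by rewrite (perm_mem sP) mem_iota /= add0n ltnn.
  have lt_idx i : (i <= n.+1)%N ->
      (index n.+1 (insert_at n.+1 i s) < index 0 (insert_at n.+1 i s))%N = (i <= index 0 s)%N.
    move=> le_i; rewrite index_insert_at ?sz // index_insert_at_neq //; lia.
  rewrite big_mkcondr (sum_insert_at f (fun i =>
     if (index n.+1 (insert_at n.+1 i s) < index 0 (insert_at n.+1 i s))%N
     then tdes n.+1 (insert_at n.+1 i s) else 0)) //.
  case: ifP => C //.
  have le_j : (find (fun x => f n.+1 <= f x) s <= n.+1)%N by rewrite -sz find_size.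
  have le_p : (index n s < n.+1)%N by rewrite -sz index_mem.
  rewrite !lt_idx // !tdes_insert_at // compat_find // ltnSn (ltnNge (index n s)) compat_find // -ltnNge.
  congr (_ + _); first by case: ifP; rewrite ?mul1r ?mul0r // mulrC.
  case: ifP => _; last by rewrite !mul0r.
  by rewrite mul1r; case: ifP; rewrite ?mulr0 // mulrC.
rewrite big_split -!mulr_sumr sum_tdes -big_mkcondr /= IHn /free_edge add0n.
by case: ltngtP => [_|_|->]; rewrite /= ?eqxx; ring.
Qed.
End PathWeight.

(** This is [maj_ge2] of the reversed word: [size s'] is the 1-based position of [y] counted from
    the right end. *)
Fixpoint gap_maj (s : seq nat) : nat :=
  if s is x :: s' then
    ((if s' is y :: _ then if x + 2 <= y then size s' else 0 else 0) + gap_maj s')%N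
  else 0%N.

Lemma chain_weight_compat (R : comUnitRingType) s f :
  chain_weight (fun x y => (~~ (x + 2 <= y)%N)%:R) (fun x y => (x + 2 <= y)%N%:R) s f
    = (compat f s)%:R :> R.
Proof.
rewrite /compat; elim: s => [|x [|y s] IHs] //=; first by rewrite mulr1.
rewrite [chain_weight _ _ _]/= in IHs; rewrite IHs /edge_weight /=.
rewrite -mulnb natrM; congr (_ * _).
by case: (x + 2 <= y)%N; rewrite ?addn1 ?addn0 !mulrb; do 2 case: ifP => //=; rewrite ?addr0 ?add0r.
Qed.

Lemma chain_value_compat (R : comUnitRingType) (q : R) s :
  chain_value q (fun x y => (~~ (x + 2 <= y)%N)%:R) (fun x y => (x + 2 <= y)%N%:R) s
    = q ^+ gap_maj s.
Proof.
elim: s => [|x [|y s] IHs] //=; first by rewrite mul1r.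
rewrite [chain_value _ _ _ _]/= in IHs; rewrite IHs exprD; congr (_ * _).
by case: ifP => _; rewrite /= ?mul1r ?add0r ?mul0r ?addr0.
Qed.

(** * Cutting paths into segments *)

(** An [edge_weight] with constant coefficients, read from right to left: a path of such edges is a
    chain on the reversed list. *)
Definition mono_edge (R : nzRingType) (a b : R) (x y : nat) : R :=
  a * (y <= x)%N%:R + b * (y < x)%N%:R.

Lemma order_local_path (R : comNzRingType) (e : nat -> nat -> R) i n :
    (forall a b a' b', (a <= b)%N = (a' <= b')%N -> (b <= a)%N = (b' <= a')%N ->
       e a b = e a' b') ->
  order_local (iota i n.+1) (path_weight e i n).
Proof.
move=> eP f g fg; apply: eq_bigr => k _; have lt_k := ltn_ord k.
by apply: eP; apply: fg; rewrite mem_iota; lia.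
Qed.

Lemma order_local_mono (R : comNzRingType) (a b : R) i n :
  order_local (iota i n.+1) (path_weight (mono_edge a b) i n).
Proof.
by apply: order_local_path => x y x' y' E E'; rewrite /mono_edge !ltnNge E E'.
Qed.

Lemma order_local_free (R : comNzRingType) (t : R) i n :
  order_local (iota i n.+1) (path_weight (free_edge t) i n).
Proof.
by apply: order_local_path => x y x' y' E E'; rewrite /free_edge E E'.
Qed.

Lemma rev_iotaS i n : rev (iota i n.+1) = (i + n)%N :: rev (iota i n).
Proof. by rewrite -addn1 iotaD rev_cat. Qed.

Lemma chain_weight_cons (R : comUnitRingType) (a b : nat -> nat -> R) x y s f :
  chain_weight a b (x :: y :: s) f = edge_weight a b f x y * chain_weight a b (y :: s) f.
Proof. by []. Qed.

Lemma chain_value_cons (R : comUnitRingType) (q : R) (a b : nat -> nat -> R) x y s :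
  chain_value q a b (x :: y :: s) =
    (a x y + b x y * q ^+ (size s).+1) * chain_value q a b (y :: s).
Proof. by []. Qed.

Section Values.
Variables (R : comUnitRingType) (q t : R).
Hypothesis qU : forall n, 1 - q ^+ n.+1 \is a GRing.unit.

Lemma lam_compat s : uniq s ->
  qlam q s (fun f => (compat f s)%:R) = (qpoch q (size s))^-1 * q ^+ gap_maj s.
Proof.
move=> us; rewrite -chain_value_compat -lam_chain //.
by apply: eq_lam => f; rewrite chain_weight_compat.
Qed.

(** By [lam_compat], [q ^+ gap_maj s] is [qpoch q n.+1] times the sum over the [f] compatible with
    [s]. Exchanging the two sums leaves, for each [f], the sum over its compatible words. *)
Lemma lam_perm_words n (P : pred (seq nat)) W :
    (forall f, \sum_(s <- perm_words n.+1 | compat f s && P s) tdes t n s = W f) ->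
  \sum_(s <- perm_words n.+1 | P s) q ^+ gap_maj s * tdes t n s
    = qpoch q n.+1 * qlam q (iota 0 n.+1) W.
Proof.
move=> WE; rewrite -(eq_lam q _ WE).
transitivity (qpoch q n.+1 * qlam q (iota 0 n.+1)
   (fun f => \sum_(s <- perm_words n.+1 | P s) tdes t n s * (compat f s)%:R)).
  rewrite lam_sum mulr_sumr big_seq_cond [RHS]big_seq_cond; apply: eq_bigr => s.
  rewrite mem_perm_words => /andP[sP _].
  rewrite lamZ -(lam_perm _ _ sP) lam_compat ?(perm_uniq sP) ?iota_uniq //.
  rewrite (perm_size sP) size_iota.
  have /divrr E : qpoch q n.+1 \is a GRing.unit by rewrite rpred_prod.
  by rewrite mulrCA [qpoch q _ * _]mulrA E mul1r mulrC.
congr (_ * _); apply: eq_lam => f; rewrite [RHS]big_mkcondl; apply: eq_bigr => s _.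
by case: ifP; rewrite ?mulr1 ?mulr0.
Qed.

Lemma path_weight_chain (a b : R) (c d : nat -> nat -> R) i n f :
    (forall x, c x.+1 x = a) -> (forall x, d x.+1 x = b) ->
  chain_weight c d (rev (iota i n.+1)) f = path_weight (mono_edge a b) i n f.
Proof.
move=> ca db; elim: n => [|n IHn]; first by rewrite /= mulr1 path_weight0.
rewrite 2!rev_iotaS chain_weight_cons -rev_iotaS IHn path_weightS mulrC.
by rewrite /edge_weight addnS ca db /mono_edge !mulr_natr.
Qed.

Lemma chain_value_rev (a b : R) (c d : nat -> nat -> R) i n :
    (forall x, c x.+1 x = a) -> (forall x, d x.+1 x = b) ->
  chain_value q c d (rev (iota i n.+1)) = \prod_(k < n) (a + b * q ^+ k.+1).
Proof.
move=> ca db; elim: n => [|n IHn]; first by rewrite /= mulr1 big_ord0.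
rewrite 2!rev_iotaS chain_value_cons -rev_iotaS IHn big_ord_recr mulrC.
by rewrite addnS ca db size_rev size_iota.
Qed.

Lemma chain_weight_rev_cat (a b : R) (c d : nat -> nat -> R) i n y s f :
    (forall x, c x.+1 x = a) -> (forall x, d x.+1 x = b) ->
  chain_weight c d (rev (iota i n.+1) ++ y :: s) f =
    path_weight (mono_edge a b) i n f * (edge_weight c d f i y * chain_weight c d (y :: s) f).
Proof.
move=> ca db; elim: n => [|n IHn]; first by rewrite path_weight0 mul1r.
rewrite 2!rev_iotaS 2!cat_cons chain_weight_cons -cat_cons -rev_iotaS IHn path_weightS.
by rewrite /edge_weight addnS ca db /mono_edge -!(mulr_natr a) -!(mulr_natr b); ring.
Qed.

Lemma chain_value_rev_cat (a b : R) (c d : nat -> nat -> R) i n y s :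
    (forall x, c x.+1 x = a) -> (forall x, d x.+1 x = b) ->
  chain_value q c d (rev (iota i n.+1) ++ y :: s) =
    (\prod_(k < n) (a + b * q ^+ ((size s).+1 + k.+1))) *
    ((c i y + d i y * q ^+ (size s).+1) * chain_value q c d (y :: s)).
Proof.
move=> ca db; elim: n => [|n IHn]; first by rewrite big_ord0 mul1r.
rewrite 2!rev_iotaS 2!cat_cons chain_value_cons -cat_cons -rev_iotaS IHn big_ord_recr /=.
rewrite addnS ca db size_cat size_rev size_iota /= -(addnC (size s).+1) -addnS; ring.
Qed.

Lemma lam_mono (a b : R) i n :
  qlam q (iota i n.+1) (path_weight (mono_edge a b) i n)
    = (qpoch q n.+1)^-1 * \prod_(k < n) (a + b * q ^+ k.+1).
Proof.
rewrite -(@chain_value_rev a b (fun _ _ => a) (fun _ _ => b) i) //.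
rewrite -[in qpoch _ _](size_iota i n.+1) -size_rev -lam_chain ?rev_uniq ?iota_uniq //.
rewrite -(lam_perm _ _ (_ : perm_eq (iota i n.+1) _)) 1?perm_sym ?perm_rev //.
by apply: eq_lam => f; rewrite (path_weight_chain (a := a) (b := b)).
Qed.

Local Notation cut_edge := (mono_edge 1 (- t)).

Lemma free_edgeE a b : free_edge t a b = t + cut_edge a b.
Proof. by rewrite /free_edge /mono_edge ltnNge; case: (a <= b)%N => /=; ring. Qed.

(** Each free edge is [t] plus a cut edge; the terms of the expansion are sorted by the last edge
    that takes [t]. *)
Lemma path_weight_last_cut i n f :
  path_weight (free_edge t) i n f = path_weight cut_edge i n f
    + t * \sum_(k < n) path_weight (free_edge t) i k f * path_weight cut_edge (i + k.+1) (n - k.+1) f.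
Proof.
elim: n => [|n IHn]; first by rewrite !path_weight0 big_ord0 mulr0 addr0.
rewrite big_ord_recr /= subnn path_weight0 mulr1.
have -> : \sum_(k < n) path_weight (free_edge t) i k f * path_weight cut_edge (i + k.+1) (n.+1 - k.+1) f
    = (\sum_(k < n) path_weight (free_edge t) i k f * path_weight cut_edge (i + k.+1) (n - k.+1) f)
        * cut_edge (f (i + n)%N) (f (i + n).+1).
  rewrite mulr_suml; apply: eq_bigr => k _; have lt_k := ltn_ord k.
  rewrite -mulrA subSn // path_weightS; congr (_ * (_ * cut_edge _ _)); congr f; lia.
by rewrite path_weightS free_edgeE (path_weightS cut_edge) mulrDr {2}IHn; ring.
Qed.

(** The same expansion sorted by the first edge that takes [t]. Using both isolates the two outer
    segments of a path. *)
Lemma path_weight_first_cut i n f :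
  path_weight (free_edge t) i n f = path_weight cut_edge i n f
    + t * \sum_(k < n) path_weight cut_edge i k f * path_weight (free_edge t) (i + k.+1) (n - k.+1) f.
Proof.
elim: n => [|n IHn]; first by rewrite !path_weight0 big_ord0 mulr0 addr0.
rewrite path_weightS {1}IHn big_ord_recr /= subnn path_weight0 mulr1.
have -> : \sum_(k < n) path_weight cut_edge i k f * path_weight (free_edge t) (i + k.+1) (n.+1 - k.+1) f
    = (\sum_(k < n) path_weight cut_edge i k f * path_weight (free_edge t) (i + k.+1) (n - k.+1) f)
        * free_edge t (f (i + n)%N) (f (i + n).+1).
  rewrite mulr_suml; apply: eq_bigr => k _; have lt_k := ltn_ord k.
  rewrite -mulrA subSn // path_weightS; congr (_ * (_ * free_edge _ _ _)); congr f; lia.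
by rewrite (path_weightS cut_edge) {1}free_edgeE [in RHS]free_edgeE; ring.
Qed.

(* path_value n and cut_value n concern paths with n edges, that is n + 1 letters. *)
Definition path_value n := qlam q (iota 0 n.+1) (path_weight (free_edge t) 0 n).
Definition cut_value n := (qpoch q n.+1)^-1 * \prod_(k < n) (1 - t * q ^+ k.+1).

Lemma lam_cut i n : qlam q (iota i n.+1) (path_weight cut_edge i n) = cut_value n.
Proof. by rewrite lam_mono; congr (_ * _); apply: eq_bigr => k _; rewrite mulNr. Qed.

(** The edge that takes [t] does not relate its two ends, so the sum factors over the letters on
    either side. *)
Lemma lam_free_rec i n :
  qlam q (iota i n.+1) (path_weight (free_edge t) i n) = cut_value n
    + t * \sum_(k < n) qlam q (iota i k.+1) (path_weight (free_edge t) i k)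
                        * cut_value (n - k.+1).
Proof.
rewrite (eq_lam _ _ (path_weight_last_cut i n)) lamD lam_cut lamZ lam_sum.
congr (_ + _ * _); apply: eq_bigr => k _; have lt_k := ltn_ord k.
rewrite (_ : n.+1 = k.+1 + (n - k.+1).+1)%N; last by lia.
rewrite iotaD lam_cat ?lam_cut //.
- by move=> j; rewrite !mem_iota; lia.
- exact: order_local_free.
- exact: order_local_mono.
Qed.

(** Translation invariance, because the recursion does not involve the first letter [i]. *)
Lemma lam_free i n : qlam q (iota i n.+1) (path_weight (free_edge t) i n) = path_value n.
Proof.
have [m] := ubnP n; elim: m n => // m IHm n lt_n.
rewrite /path_value !lam_free_rec; congr (_ + _ * _); apply: eq_bigr => k _.
by rewrite !IHm // (leq_trans (ltn_ord k)) // -ltnS.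
Qed.

Lemma path_value_rec n :
  path_value n = cut_value n + t * \sum_(k < n) path_value k * cut_value (n - k.+1).
Proof. by rewrite /path_value lam_free_rec. Qed.

(* The chain value for a + 1 letters below b + 1 letters, all edges being cut
   edges except the strict one that joins the two groups. *)
Definition strict_value a b : R :=
  q ^+ b.+1 * (\prod_(k < b) (1 - t * q ^+ k.+1) * \prod_(k < a) (1 - t * q ^+ (b.+1 + k.+1))).

(** Both segments become chains when reversed. The first then ends at 0 and the second begins at
    [c + b], so the inequality is a strict edge joining them into one chain. *)
Lemma lam_joined a b c : (a < c)%N ->
  qlam q (iota 0 a.+1 ++ iota c b.+1)
    (fun f => (f 0 < f (c + b))%N%:R * (path_weight cut_edge 0 a f * path_weight cut_edge c b f))
  = (qpoch q (a + b).+2)^-1 * strict_value a b.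
Proof.
move=> lt_ac.
(* Letters drop by 1 inside either reversed segment and the joining edge is the only rise, so
   comparing the two letters selects the coefficients. *)
pose al x y : R := (y < x)%N%:R; pose be x y : R := if (y < x)%N then - t else 1.
have alS x : al x.+1 x = 1 by rewrite /al ltnSn.
have beS x : be x.+1 x = - t by rewrite /be ltnSn.
have al0 : al 0%N (c + b)%N = 0 by rewrite /al ltn0.
have be0 : be 0%N (c + b)%N = 1 by rewrite /be ltn0.
pose s2 := rev (iota c b.+1).
have wE f : chain_weight al be (rev (iota 0 a.+1) ++ s2) f =
    (f 0 < f (c + b))%N%:R * (path_weight cut_edge 0 a f * path_weight cut_edge c b f).
  rewrite /s2 (rev_iotaS c) (chain_weight_rev_cat (a := 1) (b := - t)) // -(rev_iotaS c).
  rewrite (path_weight_chain (a := 1) (b := - t)) //.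
  by rewrite /edge_weight al0 be0 mul0rn add0r; ring.
have vE : chain_value q al be (rev (iota 0 a.+1) ++ s2) = strict_value a b.
  rewrite /s2 (rev_iotaS c) (chain_value_rev_cat (a := 1) (b := - t)) // -(rev_iotaS c).
  rewrite (chain_value_rev (a := 1) (b := - t)) // al0 be0 add0r mul1r.
  rewrite size_rev size_iota /strict_value mulrCA [X in _ * X]mulrC.
  by congr (_ * (_ * _)); apply: eq_bigr => k _; rewrite mulNr.
have pE : perm_eq (iota 0 a.+1 ++ iota c b.+1) (rev (iota 0 a.+1) ++ s2).
  by rewrite perm_cat // perm_sym perm_rev.
rewrite (lam_perm _ _ pE) -(eq_lam _ _ wE) lam_chain //; last first.
  rewrite -(perm_uniq pE) cat_uniq !iota_uniq andbT andTb; apply/hasPn => x.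
  by rewrite !mem_iota; lia.
rewrite vE size_cat !size_rev !size_iota; congr ((qpoch _ _)^-1 * _); lia.
Qed.

(** The strict edge takes every place in a joined segment of [n] letters; [j.+1] of them precede it
    in the chain. *)
Definition strict_sum n : R :=
  (qpoch q n)^-1 * \sum_(j < n.-1) strict_value j (n.-2 - j).

Lemma big_triangle n (G : nat -> nat -> R) :
  \sum_(k < n) \sum_(j < k) G j (k - j.+1)%N = \sum_(i < n) \sum_(j < n - i.+1) G j i.
Proof.
elim: n => [|n IHn]; first by rewrite !big_ord0.
rewrite !big_ord_recr /= subnn big_ord0 addr0 IHn.
have -> : \sum_(i < n) \sum_(j < n.+1 - i.+1) G j i =
    \sum_(i < n) (\sum_(j < n - i.+1) G j i + G (n - i.+1)%N i).
  by apply: eq_bigr => i _; rewrite subSn // big_ord_recr.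
rewrite big_split /=; congr (_ + _); rewrite (reindex_inj rev_ord_inj) /=.
by apply: eq_bigr => i _; congr G; have := ltn_ord i; lia.
Qed.

(** The term where no edge takes [t] vanishes, since cut edges force [f n <= f 0]. Otherwise let [j]
    and [k] be the first and the last edge taking [t]: the inequality joins the two outer segments,
    and the letters between form a free path. The case [j = k] gives the term in [t], the case
    [j < k] the one in [t ^+ 2]. *)
Lemma lam_descent n :
  qlam q (iota 0 n.+1) (fun f => (f 0 < f n)%N%:R * path_weight (free_edge t) 0 n f)
    = t * strict_sum n.+1 + t ^+ 2 * \sum_(i < n) path_value i * strict_sum (n - i).
Proof.
pose G k j := qlam q (iota 0 n.+1) (fun f => (f 0 < f n)%N%:R *
    (path_weight cut_edge 0 j f * path_weight cut_edge k.+1 (n - k.+1) f)).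
pose H k j := qlam q (iota 0 n.+1) (fun f => (f 0 < f n)%N%:R *
    (path_weight cut_edge 0 j f * path_weight cut_edge k.+1 (n - k.+1) f) *
    path_weight (free_edge t) j.+1 (k - j.+1) f).
have cut0 f : (f 0 < f n)%N%:R * path_weight cut_edge 0 n f = 0.
  rewrite -(path_weight_chain (c := fun _ _ => 1) (d := fun _ _ => - t)) // rev_iotaS.
  have [lt_f|] := ltnP; last by rewrite mul0r.
  rewrite mul1r; apply: (@chain_weight_eq0 _ _ _ _ _ _ 0%N) => //.
  rewrite mem_rev mem_iota add0n /=; case: (n) lt_f => //; by rewrite ltnn.
transitivity (t * \sum_(k < n) G k k + t ^+ 2 * \sum_(k < n) \sum_(j < k) H k j).
  rewrite mulr_sumr [t ^+ 2 * _]mulr_sumr -big_split /=.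
  under [RHS]eq_bigr => k _.
    rewrite /G /H -lam_sum -!lamZ -lamD; over.
  rewrite -lam_sum; apply: eq_lam => f.
  rewrite path_weight_last_cut mulrDr cut0 add0r mulrCA !mulr_sumr; apply: eq_bigr => k _.
  rewrite path_weight_first_cut add0n.
  rewrite (eq_bigr (fun j : 'I_k => path_weight cut_edge 0 j f *
     path_weight (free_edge t) j.+1 (k - j.+1) f)) => [|j _]; last by rewrite add0n.
  rewrite mulrDl !mulrDr; congr (_ + _).
  rewrite [RHS](_ : _ = t ^+ 2 * \sum_(j < k) ((f 0 < f n)%N%:R *
    path_weight cut_edge k.+1 (n - k.+1) f) * (path_weight cut_edge 0 j f *
     path_weight (free_edge t) j.+1 (k - j.+1) f)).
    by rewrite -mulr_sumr; ring.
  by congr (_ * _); apply: eq_bigr => j _; ring.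
have GE k : (k < n)%N -> G k k = (qpoch q n.+1)^-1 * strict_value k (n - k.+1).
  move=> lt_k; rewrite /G (_ : iota 0 n.+1 = iota 0 k.+1 ++ iota k.+1 (n - k.+1).+1); last first.
    by rewrite -iotaD; congr iota; lia.
  have := @lam_joined k (n - k.+1) k.+1 (ltnSn k).
  rewrite (_ : (k.+1 + (n - k.+1))%N = n); last by lia.
  by move=> ->; congr ((qpoch _ _)^-1 * _); lia.
have HE k j : (k < n)%N -> (j < k)%N -> H k j =
    (qpoch q (n - (k - j.+1)))^-1 * strict_value j (n - k.+1) * path_value (k - j.+1).
  move=> lt_k lt_j; rewrite /H.
  (* The middle letters go last, which makes the two outer segments adjacent. *)
  have pE : perm_eq (iota 0 n.+1)
      ((iota 0 j.+1 ++ iota k.+1 (n - k.+1).+1) ++ iota j.+1 (k - j.+1).+1).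
    rewrite (_ : n.+1 = j.+1 + ((k - j.+1).+1 + (n - k.+1).+1))%N; last by lia.
    rewrite !iotaD -catA perm_cat2l perm_catC !add0n.
    by rewrite (_ : (j.+1 + (k - j.+1).+1)%N = k.+1) ?perm_refl //; lia.
  rewrite (lam_perm _ _ pE) lam_cat //.
  - rewrite lam_free; congr (_ * _).
    have := @lam_joined j (n - k.+1) k.+1 (ltnW lt_j).
    rewrite (_ : (k.+1 + (n - k.+1))%N = n); last by lia.
    by move=> ->; congr ((qpoch _ _)^-1 * _); lia.
  - by move=> i; rewrite mem_cat !mem_iota; lia.
  - apply: order_local_op.
      by apply: (order_local_app (fun x : bool => x%:R)); apply: order_local_lt; rewrite mem_cat !mem_iota; lia.
    by apply: order_local_op;
      [apply: order_localS (@order_local_mono _ 1 (- t) 0 j)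
       | apply: order_localS (@order_local_mono _ 1 (- t) k.+1 (n - k.+1))] => i;
      rewrite mem_cat => ->; rewrite ?orbT.
  - exact: order_local_free.
congr (_ * _ + _ * _).
  rewrite /strict_sum /= mulr_sumr; apply: eq_bigr => k _.
  by rewrite GE //; congr (_ * strict_value _ _); have := ltn_ord k; lia.
pose G' j i := (qpoch q (n - i))^-1 * strict_value j (n - (i + j.+1).+1) * path_value i.
transitivity (\sum_(k < n) \sum_(j < k) G' j (k - j.+1)%N).
  apply: eq_bigr => k _; apply: eq_bigr => j _; have lt_k := ltn_ord k; have lt_j := ltn_ord j.
  by rewrite HE // /G'; congr (_ * strict_value _ _ * _); lia.
rewrite big_triangle; apply: eq_bigr => i _; have lt_i := ltn_ord i.
rewrite /strict_sum mulrCA !mulr_sumr (_ : (n - i).-1 = n - i.+1)%N; last by lia.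
apply: eq_bigr => j _; have lt_j := ltn_ord j; rewrite /G' -mulrA; congr (_ * _).
by rewrite mulrC; congr (_ * strict_value _ _); lia.
Qed.

(** Equality is [mono_edge 1 (-1)], for which the product in [lam_mono] is [qpoch q n]; it cancels
    all but the last factor of [qpoch q n.+1]. *)
Lemma lam_const n :
  qlam q (iota 0 n.+1) (path_weight (fun a b => (a == b)%:R) 0 n) = (1 - q ^+ n.+1)^-1.
Proof.
have -> : path_weight (fun a b => (a == b)%:R) 0 n = path_weight (mono_edge 1 (-1)) 0 n :> (_ -> R).
  apply/funext => f; apply: eq_bigr => k _; rewrite /mono_edge.
  by case: ltngtP => _ /=; ring.
rewrite lam_mono qpochS invrM ?qU // ?rpred_prod // -mulrA.
rewrite (_ : \prod_(k < n) _ = qpoch q n); last by apply: eq_bigr => k _; rewrite mulN1r.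
by rewrite mulVr ?mulr1 // rpred_prod.
Qed.
End Values.

(** * Generating series *)

Lemma coef_fps_constM (R : comNzRingType) (a : R) (f : {fps R}) n :
  fcoef (fps_const a * f) n = a * fcoef f n.
Proof.
rewrite coef_fpsM big_ord_recl subn0 big1 ?addr0 // => i _.
by rewrite /= mul0r.
Qed.

Lemma coef_fpsD (R : zmodType) (f g : {fps R}) n :
  fcoef (f + g) n = fcoef f n + fcoef g n.
Proof. by []. Qed.

Lemma coef_fpsN (R : zmodType) (f : {fps R}) n : fcoef (- f) n = - fcoef f n.
Proof. by []. Qed.

Lemma coef_fpsM_pos (R : comNzRingType) (f g : {fps R}) n :
    fcoef f 0 = 0 -> fcoef g 0 = 0 ->
  fcoef (f * g) n.+1 = \sum_(i < n) fcoef f i.+1 * fcoef g (n - i).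
Proof.
move=> f0 g0; rewrite coef_fpsM big_ord_recl f0 mul0r add0r big_ord_recr /=.
by rewrite subSS subnn g0 mulr0 addr0.
Qed.

Section Series.
Variables (R : comUnitRingType) (q t c : R).
Hypothesis qU : forall n, 1 - q ^+ n.+1 \is a GRing.unit.

(** For [c] equal to [1 - q] the scaling turns $1/(q;q)_n$ into $1/[n]_q!$. The shift accounts for
    [F m] concerning paths with [m] edges, hence [m.+1] letters. *)
Definition egf_pos (F : nat -> R) : {fps R} :=
  \fps_n if n is m.+1 then c ^+ m.+1 * F m else 0.

Definition exp_series : {fps R} := \fps_n (c ^+ n * (qpoch q n)^-1).

Local Notation Fs := (egf_pos (path_value q t)).
Local Notation Vs := (egf_pos (cut_value q t)).
Local Notation Xs := (egf_pos (fun n => strict_sum q t n.+1)).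
Local Notation E := exp_series.
Local Notation Et := (fps_dilate t exp_series).

Lemma path_series : Fs = Vs + fps_const t * (Fs * Vs).
Proof.
apply/fpsP => -[|n]; rewrite coef_fpsD coef_fps_constM.
  by rewrite coef_fpsM big_ord1 /= mul0r mulr0 addr0.
rewrite coef_fpsM_pos //= path_value_rec // mulrDr [c ^+ _ * (t * _)]mulrCA mulr_sumr.
congr (_ + _ * _).
apply: eq_bigr => i _; have lt_i := ltn_ord i.
rewrite (_ : (n - i = (n - i.+1).+1)%N) /=; last by lia.
by rewrite [RHS]mulrACA -exprD; congr (c ^+ _ * _); lia.
Qed.

Lemma descent_series :
  egf_pos (fun n => qlam q (iota 0 n.+1)
      (fun f => (f 0 < f n)%N%:R * path_weight (free_edge t) 0 n f))
    = fps_const t * Xs + fps_const (t ^+ 2) * (Fs * Xs).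
Proof.
apply/fpsP => -[|n]; rewrite coef_fpsD !coef_fps_constM.
  by rewrite coef_fpsM big_ord1 /= mul0r !mulr0 addr0.
rewrite coef_fpsM_pos //= lam_descent // mulrDr [c ^+ _ * (t * _)]mulrCA.
rewrite [c ^+ _ * (t ^+ 2 * _)]mulrCA mulr_sumr; congr (_ + _ * _).
apply: eq_bigr => i _; have lt_i := ltn_ord i.
rewrite (_ : (n - i = (n - i.+1).+1)%N) /=; last by lia.
by rewrite [RHS]mulrACA -exprD; congr (c ^+ _ * _); lia.
Qed.

Local Notation e n := (qpoch q n)^-1.

Lemma qpochV_S n : (1 - q ^+ n.+1) * e n.+1 = e n.
Proof. by rewrite qpochS invrM ?rpred_prod // mulrA divrr ?mul1r. Qed.

(* The q-binomial theorem. *)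
Lemma cut_qbinomial n :
  \sum_(k < n.+1) t ^+ k * e k * (e (n - k) * \prod_(i < n - k) (1 - t * q ^+ i)) = e n.
Proof.
pose y m := e m * \prod_(i < m) (1 - t * q ^+ i).
have yS m : (1 - q ^+ m.+1) * y m.+1 = (1 - t * q ^+ m) * y m.
  by rewrite /y mulrA qpochV_S big_ord_recr /=; ring.
elim: n => [|n IHn].
  by rewrite big_ord1 subnn big_ord0 /qpoch big_ord0 invr1 !mulr1.
apply: (mulrI (qU n)); rewrite qpochV_S -IHn mulr_sumr.
(* [1 - q ^+ n.+1] is shared out between the two factors; once the second half is shifted by one,
   the terms with [t * q ^+ (n - k)] cancel. *)
have split_q k : (k < n.+2)%N -> (1 - q ^+ n.+1) * (t ^+ k * e k * y (n.+1 - k)%N) =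
    t ^+ k * e k * ((1 - q ^+ (n.+1 - k)) * y (n.+1 - k)%N)
    + t ^+ k * ((1 - q ^+ k) * e k) * (q ^+ (n.+1 - k) * y (n.+1 - k)%N).
  by move=> lt_k; rewrite -{1}(@subnK k n.+1) // exprD; ring.
under eq_bigr => k _ do rewrite split_q //.
rewrite big_split /= big_ord_recr /= subnn expr0 subrr mul0r mulr0 addr0.
rewrite [X in _ + X]big_ord_recl /= expr0 subrr !mul0r mulr0 mul0r add0r -big_split.
apply: eq_bigr => k _; have lt_k := ltn_ord k.
rewrite /bump /= add1n subSS qpochV_S subSn // yS exprS /y; ring.
Qed.

(** [1 - t] is the factor [i = 0] missing from [cut_value], which brings the coefficients into the
    form of [cut_qbinomial]. *)
Lemma exp_cut : Et * (1 + fps_const (1 - t) * Vs) = E.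
Proof.
have uE n : fcoef (1 + fps_const (1 - t) * Vs) n = c ^+ n * (e n * \prod_(i < n) (1 - t * q ^+ i)).
  rewrite coef_fpsD coef_fps_constM; case: n => [|n] /=.
    by rewrite big_ord0 /qpoch big_ord0 invr1 mulr0 !mulr1 addr0.
  rewrite add0r big_ord_recl /cut_value expr0 mulr1; ring.
apply/fpsP => n; rewrite coef_fpsM -[RHS]/(_ * _) -cut_qbinomial mulr_sumr.
apply: eq_bigr => k _; have le_k : (k <= n)%N by rewrite -ltnS.
have cE : c ^+ n = c ^+ k * c ^+ (n - k) by rewrite -exprD subnKC.
by rewrite uE /= cE; ring.
Qed.

(** Telescopes, since [q ^+ j * e j = e j - e j.-1] for positive [j]. *)
Lemma qpochV_sum n : \sum_(j < n.+1) q ^+ j * e j = e n.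
Proof.
elim: n => [|n IHn]; first by rewrite big_ord1 mul1r.
by rewrite big_ord_recr /= IHn -(qpochV_S n); ring.
Qed.

(* E'/E = sum_(n >= 1) z^(n-1) / (1 - q^n) for E = sum_n z^n / (q; q)_n. *)
Lemma qpochV_log n : \sum_(i < n.+1) (1 - q ^+ i.+1)^-1 * e (n - i) = n.+1%:R * e n.+1.
Proof.
elim: n => [|n IHn].
  by rewrite big_ord1 subnn /qpoch big_ord0 big_ord1 invr1 mulr1 mul1r.
apply: (mulrI (qU n.+1)); rewrite mulrCA qpochV_S mulr_sumr.
(* The first half is the induction hypothesis, the second one sums to [e n.+1] by [qpochV_sum]. *)
have split_q i : (i < n.+2)%N -> (1 - q ^+ n.+2) * ((1 - q ^+ i.+1)^-1 * e (n.+1 - i)) =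
    (1 - q ^+ i.+1)^-1 * ((1 - q ^+ (n.+1 - i)) * e (n.+1 - i))
    + q ^+ (n.+1 - i) * e (n.+1 - i).
  move=> lt_i; have := mulVr (qU i) => qV.
  rewrite -[X in _ = _ + X]mul1r -[X in _ = _ + X * _]qV.
  have -> : q ^+ n.+2 = q ^+ (n.+1 - i) * q ^+ i.+1 by rewrite -exprD; congr (q ^+ _); lia.
  by ring.
under eq_bigr => i _ do rewrite split_q //.
rewrite big_split /= big_ord_recr /= subnn expr0 subrr mul0r mulr0 addr0.
rewrite (eq_bigr (fun i : 'I_n.+1 => (1 - q ^+ i.+1)^-1 * e (n - i))) => [|i _]; last first.
  by rewrite subSn ?qpochV_S // -ltnS.
rewrite IHn (reindex_inj rev_ord_inj) /=.
rewrite (eq_bigr (fun i : 'I_n.+2 => q ^+ i * e i)) => [|i _]; last first.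
  by rewrite subSS subKn // -ltnS.
by rewrite qpochV_sum -[in RHS]natr1 mulrDl mul1r.
Qed.

(** The right-hand side is the $t$-derivative of [Et], written out because [t] is a mere ring
    element here. Multiplied by [t] it is $z\,d/dz$ of [Et], which is why [qpochV_log] applies. *)
Lemma log_exp :
  egf_pos (fun n => t ^+ n * (1 - q ^+ n.+1)^-1) * Et
    = \fps_n (n%:R * t ^+ n.-1 * fcoef E n).
Proof.
apply/fpsP => -[|n]; rewrite coef_fpsM; first by rewrite big_ord1 /= !mul0r.
rewrite big_ord_recl /= mul0r add0r.
transitivity (c ^+ n.+1 * t ^+ n * \sum_(i < n.+1) (1 - q ^+ i.+1)^-1 * e (n - i)).
  rewrite mulr_sumr; apply: eq_bigr => i _; rewrite /bump /= add1n subSS.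
  have le_i : (i <= n)%N by rewrite -ltnS.
  have cE x : x ^+ n = x ^+ i * x ^+ (n - i) :> R by rewrite -exprD subnKC.
  by rewrite !exprS !cE; ring.
by rewrite qpochV_log; ring.
Qed.
End Series.

(** * Permutations as words *)

Lemma size_perm_words n : size (perm_words n) = n`!.
Proof. by elim: n => // n IHn; rewrite size_allpairs size_iota IHn factS mulnC. Qed.

Lemma gap_majE w : gap_maj w = (\sum_(k < (size w).-1)
   if nth 0 w k + 2 <= nth 0 w k.+1 then size w - k.+1 else 0)%N.
Proof.
elim: w => [|x [|y w] IHw]; rewrite ?big_ord0 //.
by rewrite [LHS]/= -/(gap_maj (y :: w)) IHw [in RHS]/= big_ord_recl /= subSS subn0.
Qed.

(* The inverse of s read backwards: letter number k is the position of the
   value n - 1 - k in s. *)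
Definition perm_word n (s : 'S_n) : seq nat :=
  [seq val ((s^-1)%g (rev_ord k)) | k <- enum 'I_n].

Lemma nth_perm_word n (s : 'S_n) (k : 'I_n) : nth 0%N (perm_word s) k = (s^-1)%g (rev_ord k).
Proof. by rewrite (nth_map k) ?size_enum_ord // nth_ord_enum. Qed.

Lemma size_perm_word n (s : 'S_n) : size (perm_word s) = n.
Proof. by rewrite size_map size_enum_ord. Qed.

Lemma perm_word_uniq n (s : 'S_n) : uniq (perm_word s).
Proof.
rewrite map_inj_uniq ?enum_uniq // => i j /val_inj /perm_inj; exact: rev_ord_inj.
Qed.

Lemma perm_word_inj n : injective (@perm_word n).
Proof.
move=> s s' eq_s; apply: invg_inj; apply/permP => i; apply: val_inj.
have := nth_perm_word s (rev_ord i); have := nth_perm_word s' (rev_ord i).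
by rewrite /= rev_ordK eq_s => <- <-.
Qed.

Lemma index_perm_word n (s : 'S_n) (k : 'I_n) : index (k : nat) (perm_word s) = (n - (s k).+1)%N.
Proof.
have := nth_perm_word s (rev_ord (s k)); rewrite rev_ordK permK => {1}<-.
by rewrite index_uniq ?perm_word_uniq ?size_perm_word.
Qed.

Lemma perm_words_perm n : perm_eq [seq perm_word s | s <- enum 'S_n] (perm_words n).
Proof.
have us : uniq [seq perm_word s | s <- enum 'S_n].
  by rewrite map_inj_uniq ?enum_uniq //; apply: perm_word_inj.
have sub : {subset [seq perm_word s | s <- enum 'S_n] <= perm_words n}.
  move=> _ /mapP[s _ ->]; rewrite mem_perm_words.
  have [|//|_ eq_w] := uniq_min_size (perm_word_uniq s) (_ : {subset _ <= iota 0 n}).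
  - by move=> _ /mapP[k _ ->]; rewrite mem_iota /=.
  - by rewrite size_perm_word size_iota.
  by apply: uniq_perm; rewrite ?perm_word_uniq ?iota_uniq.
have [|_ eq_w] := uniq_min_size us sub; last first.
  by apply: uniq_perm => //; apply: perm_words_uniq.
by rewrite size_perm_words size_map -cardE card_Sn.
Qed.

Lemma big_perm_word (R : nmodType) n (P : pred (seq nat)) (F : seq nat -> R) :
  \sum_(s : 'S_n | P (perm_word s)) F (perm_word s) = \sum_(w <- perm_words n | P w) F w.
Proof. by rewrite -(perm_big _ (perm_words_perm n)) big_map big_enum_cond. Qed.

Lemma gap_maj_perm_word n (s : 'S_n.+1) : gap_maj (perm_word s) = maj_ge2 s^-1.
Proof.
(* The last position has no successor and drops out; the others correspond to the gaps of the word
   in reverse order. *)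
rewrite gap_majE size_perm_word /maj_ge2 [RHS]big_mkcond [RHS]big_ord_recr /= ltnn addn0.
rewrite (reindex_inj rev_ord_inj) /=; apply: eq_bigr => k _.
have lt_k := ltn_ord k.
have k1 : (n - k.+1 < n.+1)%N by lia.
have k2 : ((n - k.+1).+1 < n.+1)%N by lia.
rewrite (nth_perm_word s (Ordinal k1)) (nth_perm_word s (Ordinal k2)) ltnS lt_k /=.
rewrite (_ : rev_ord (Ordinal k1) = ordS (widen_ord (leqnSn n) k)); last first.
  by apply: val_inj; rewrite /= modn_small; lia.
rewrite (_ : rev_ord (Ordinal k2) = widen_ord (leqnSn n) k); last first.
  by apply: val_inj; rewrite /=; lia.
by case: ifP => // _; lia.
Qed.

Lemma lt_index_perm_word n (s : 'S_n) (i j : 'I_n) :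
  (index (i : nat) (perm_word s) < index (j : nat) (perm_word s))%N = (s j < s i)%N.
Proof. by rewrite !index_perm_word; have := ltn_ord (s i); have := ltn_ord (s j); lia. Qed.

Section Descents.
Variables (R : comNzRingType) (t : R) (n : nat).
Implicit Type s : 'S_n.+1.

Lemma tdes_perm_word s : tdes t n (perm_word s) = t ^+ des s.
Proof.
rewrite /des -prodr_const big_mkcond big_ord_recr /= !inE /= ltnn mulr1.
apply: eq_bigr => k _; rewrite !inE /= ltnS ltn_ord /=.
have -> : index k.+1 (perm_word s) = index (ordS (widen_ord (leqnSn n) k) : nat) (perm_word s).
  by rewrite /= modn_small ?ltnS.
by rewrite (lt_index_perm_word s (widen_ord (leqnSn n) k)).
Qed.

Lemma cdesE s : cdes s = (des s + (s ord0 < s ord_max)%N)%N.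
Proof.
rewrite /cdes /des -!sum1dep_card [LHS]big_mkcond [in RHS]big_mkcond /= !big_ord_recr /=.
rewrite ltnn addn0; congr (_ + _)%N.
  by apply: eq_bigr => k _; rewrite ltnS ltn_ord.
rewrite (_ : ordS ord_max = ord0); last by apply: val_inj; rewrite /= modnn.
by case: ifP.
Qed.
End Descents.

Lemma AltE n : Alt n.+1 =
  \sum_(w <- perm_words n.+1 | (index n w < index 0%N w)%N) q%:P ^+ gap_maj w * tdes t n w.
Proof.
rewrite -big_perm_word /Alt; apply: eq_big => s.
  by rewrite (lt_index_perm_word s ord_max ord0).
by move=> _; rewrite gap_maj_perm_word tdes_perm_word -polyC_exp mul_polyC.
Qed.

(** When the cyclic descent at the end is present, [t ^+ cdes s] is
    [t ^+ des s - (1 - t) * t ^+ des s]. *)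
Lemma AtildeE n : Atilde n.+1 =
  \sum_(w <- perm_words n.+1) q%:P ^+ gap_maj w * tdes t n w - (1 - t) * Alt n.+1.
Proof.
rewrite /Alt [X in _ * X]big_mkcond mulr_sumr -(@big_perm_word _ n.+1 xpredT) -sumrB; apply: eq_bigr => s _.
rewrite gap_maj_perm_word tdes_perm_word -polyC_exp mul_polyC cdesE exprD -!mul_polyC.
by case: ifP => _; rewrite /= ?expr1 ?expr0; ring.
Qed.

(** * The identities *)

Lemma fps_map_derivM (K : comNzRingType) (f g : {fps {poly K}}) :
  fps_map (@deriv K) (f * g) = fps_map (@deriv K) f * g + f * fps_map (@deriv K) g.
Proof.
apply/fpsP => n; rewrite coef_fpsD !coef_fpsM /= raddf_sum -big_split.
by apply: eq_bigr => i _; rewrite /= derivM.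
Qed.

Lemma fps_map_derivD (K : comNzRingType) (f g : {fps {poly K}}) :
  fps_map (@deriv K) (f + g) = fps_map (@deriv K) f + fps_map (@deriv K) g.
Proof. by apply/fpsP => n; rewrite /= derivD. Qed.

Lemma fps_map_deriv_const (K : comNzRingType) (p : {poly K}) :
  fps_map (@deriv K) (fps_const p) = fps_const p^`().
Proof. by apply/fpsP => -[|n]; rewrite //= deriv0. Qed.

Section Numerators.
Variables (K : fieldType) (x : K).
Hypothesis x_neq0 : forall n, 1 - x ^+ n.+1 != 0.
Local Notation T := ('X : {poly K}).
Local Notation xP := (x%:P : {poly K}).
Local Notation cP := ((1 - x)%:P : {poly K}).
Local Notation ddT := (fps_map (@deriv K)).

Lemma subr1_polyCX_unit n : 1 - xP ^+ n.+1 \is a GRing.unit.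
Proof. by rewrite -polyC_exp -polyC1 -polyCB rmorph_unit // unitfE x_neq0. Qed.
Let xU := subr1_polyCX_unit.

Lemma qpoch_polyC n : qpoch xP n = (qpoch x n)%:P.
Proof.
by rewrite /qpoch rmorph_prod; apply: eq_bigr => i _; rewrite rmorphB rmorph1 rmorphXn.
Qed.

Lemma qpoch_neq0 n : qpoch x n != 0.
Proof. by apply/prodf_neq0 => i _; apply: x_neq0. Qed.

Lemma qpoch_bracket n : (1 - x) ^+ n * \prod_(i < n) bracket i.+1 x = qpoch x n.
Proof.
rewrite /qpoch -[in X in _ ^+ X](card_ord n) -prodr_const -big_split.
by apply: eq_bigr => i _ /=; rewrite -opprB mulNr /bracket -subrX1 opprB.
Qed.

Lemma bracket_prodV n :
  ((\prod_(i < n) bracket i.+1 x)^-1)%:P = cP ^+ n * (qpoch xP n)^-1.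
Proof.
apply: (canRL (mulrK _)); first by rewrite rpred_prod // => i _; apply: xU.
rewrite qpoch_polyC -qpoch_bracket -polyCM -polyC_exp mulrCA mulVf ?mulr1 //.
by apply: contraNneq (qpoch_neq0 n) => q0; rewrite -qpoch_bracket q0 mulr0.
Qed.

Local Notation E := (exp_series xP cP).
Local Notation Et := (fps_dilate T E).
Local Notation Fs := (egf_pos cP (path_value xP T)).
Local Notation Vs := (egf_pos cP (cut_value xP T)).
Local Notation Xs := (egf_pos cP (fun n => strict_sum xP T n.+1)).
Local Notation D := (Et - fps_const T * E).

(** The product rule, term by term: [strict_value j b] is the product with its factor of exponent
    [b.+1] replaced by [xP ^+ b.+1]. *)
Lemma strict_sum_deriv n :
  (\prod_(k < n) (1 - T * xP ^+ k.+1))^`()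
    = - \sum_(j < n) strict_value xP T j (n.-1 - j).
Proof.
elim: n => [|n IHn]; first by rewrite !big_ord0 derivC oppr0.
rewrite big_ord_recr derivM IHn /= big_ord_recl subn0.
have -> : \sum_(j < n) strict_value xP T (lift ord0 j) (n - lift ord0 j) =
   (\sum_(j < n) strict_value xP T j (n.-1 - j)) * (1 - T * xP ^+ n.+1).
  rewrite mulr_suml; apply: eq_bigr => j _; have lt_j := ltn_ord j.
  rewrite lift0 /strict_value big_ord_recr /=.
  rewrite (_ : n - j.+1 = n.-1 - j)%N; last by lia.
  by rewrite (_ : (n.-1 - j).+1 + j.+1 = n.+1)%N; [ring | lia].
have -> : (1 - T * xP ^+ n.+1)^`() = - xP ^+ n.+1.
  by rewrite derivB derivC derivM derivX -polyC_exp derivC mulr0 addr0 mul1r sub0r.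
by rewrite /strict_value big_ord0; ring.
Qed.

Lemma ddT_cut : ddT Vs = - Xs.
Proof.
apply/fpsP => -[|n]; first by rewrite coef_fpsN /= deriv0 oppr0.
rewrite coef_fpsN /= /cut_value /strict_sum -polyC_exp qpoch_polyC.
rewrite -[(_%:P)^-1]fmorphV derivM derivC mul0r add0r derivM derivC mul0r add0r.
by rewrite strict_sum_deriv !mulrN.
Qed.

Lemma coef_expE n : fcoef E n = ((\prod_(i < n) bracket i.+1 x)^-1)%:P.
Proof. by rewrite bracket_prodV. Qed.

Lemma ddT_dilate : ddT Et = \fps_n (n%:R * T ^+ n.-1 * fcoef E n).
Proof.
apply/fpsP => n; rewrite [LHS]/= -[_ * _]/(T ^+ n * fcoef E n) coef_expE.
rewrite derivM derivC mulr0 addr0 derivXn -mulr_natl.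
by rewrite -[RHS]/(n%:R * T ^+ n.-1 * fcoef E n) coef_expE.
Qed.

Lemma bracketE n : (1 - T) * bracket n T = 1 - T ^+ n.
Proof. by rewrite -[1 - T]opprB mulNr /bracket -subrX1 opprB. Qed.

Lemma bracket_deriv n : (1 - T) * (bracket n T)^`() = bracket n T - n%:R * T ^+ n.-1.
Proof.
have := congr1 (@deriv K) (bracketE n).
rewrite derivM !derivB !derivC derivX derivXn -mulr_natl !sub0r mulN1r => H.
by rewrite -[LHS](addKr (- bracket n T)) opprK H.
Qed.

Lemma subr1_polyX_neq0 : 1 - T != 0.
Proof. by rewrite -opprB oppr_eq0 polyXsubC_eq0. Qed.

(** [exp_cut] says that [E - Et] is [1 - T] times the left-hand side, and [1 - T] can be cancelled
    from [1 - T ^+ n]. *)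
Lemma exp_cut_bracket : Et * Vs = \fps_n (fcoef E n * bracket n T).
Proof.
have H := exp_cut T cP xU.
have {}H : fps_const (1 - T) * (Et * Vs) = E - Et by rewrite -[X in _ = X - _]H; ring.
apply/fpsP => n; apply: (mulfI subr1_polyX_neq0); rewrite -coef_fps_constM H.
rewrite coef_fpsD coef_fpsN -[RHS]/((1 - T) * (fcoef E n * bracket n T)) mulrCA bracketE.
by rewrite -[fcoef Et n]/(T ^+ n * fcoef E n); ring.
Qed.

Lemma numeratorE :
  fps_const (1 - T) * ddT (\fps_n if (2 <= n)%N then
     (\prod_(i < n) bracket i.+1 x)^-1 *: bracket n T else 0) = Et * Vs - ddT Et.
Proof.
rewrite exp_cut_bracket ddT_dilate; apply/fpsP => n.
rewrite coef_fps_constM coef_fpsD coef_fpsN [X in _ * X]/=.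
rewrite -[RHS]/(fcoef E n * bracket n T - n%:R * T ^+ n.-1 * fcoef E n) coef_expE.
case: ltnP => [lt_n|].
  by rewrite -mul_polyC derivM derivC mul0r add0r mulrCA bracket_deriv; ring.
(* In degrees 0 and 1 the right-hand side vanishes, which is why the sum may start at 2. *)
case: n => [|[|]] // _; rewrite deriv0 mulr0 /bracket.
  by rewrite [X in _ * X - _]big_ord0 mulr0 !mul0r subrr.
by rewrite [X in _ * X - _]big_ord1 expr0 !mul1r mulr1 subrr.
Qed.

Lemma fps_constB1 : fps_const (1 - T) = 1 - fps_const T.
Proof. by apply/fpsP => -[|n] //=; rewrite subr0. Qed.

(** [exp_cut] factors [D] as $(1-t)E_t(1-tV)$, and $F(1-tV)=V$ by [path_series]. *)
Lemma denominator_path : Fs * D = E - Et.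
Proof.
have H := exp_cut T cP xU; have F := path_series T cP xU.
rewrite fps_constB1 in H; move: Et Fs Vs (fps_const T) H F => e F V S <- FE.
transitivity (e * (1 - S) * (F - S * (F * V))); first by ring.
by rewrite {1}FE; ring.
Qed.

(** In the factorization $D=(1-t)E_t(1-tV)$ the last factor has inverse $1+tF$, which clears [Fs]
    from the descent series. The remaining [Xs] is eliminated by differentiating [exp_cut] in
    $t$. *)
Lemma denominator_alt :
  egf_pos cP (fun n => path_value xP T n - qlam xP (iota 0 n.+1)
      (fun f => (f 0 < f n)%N%:R * path_weight (free_edge T) 0 n f)
      - T ^+ n * (1 - xP ^+ n.+1)^-1) * D
  = Et * Vs - ddT Et.
Proof.
pose Ds := egf_pos cP (fun n => qlam xP (iota 0 n.+1)
  (fun f => (f 0 < f n)%N%:R * path_weight (free_edge T) 0 n f)).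
pose Ls := egf_pos cP (fun n => T ^+ n * (1 - xP ^+ n.+1)^-1).
have -> : egf_pos cP (fun n => path_value xP T n - qlam xP (iota 0 n.+1)
      (fun f => (f 0 < f n)%N%:R * path_weight (free_edge T) 0 n f)
      - T ^+ n * (1 - xP ^+ n.+1)^-1) = Fs - Ds - Ls.
  by apply/fpsP => -[|n]; rewrite !(coef_fpsD, coef_fpsN) /= ?subr0 // !mulrBr.
have H := exp_cut T cP xU; have FE := path_series T cP xU.
have DsE : Ds = fps_const T * Xs + fps_const (T ^+ 2) * (Fs * Xs).
  exact: (descent_series T cP xU).
have LE : Ls * Et = ddT Et by rewrite ddT_dilate; apply: log_exp; apply: xU.
have dH := congr1 ddT H.
have t2E : fps_const (T ^+ 2) = fps_const T * fps_const T.
  by apply/fpsP => n; rewrite coef_fps_constM; case: n => [|n] /=; rewrite ?mulr0.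
have dE : ddT E = 0.
  by apply/fpsP => n; rewrite -[LHS]/((fcoef E n)^`()) coef_expE derivC.
have d1 : ddT 1 = 0 by rewrite (fps_map_deriv_const 1) derivC; apply/fpsP => -[|n].
rewrite dE fps_map_derivM fps_map_derivD fps_map_derivM ddT_cut in dH.
rewrite d1 fps_map_deriv_const derivB derivC derivX in dH.
rewrite (_ : fps_const (0 - 1) = - 1) in dH; last first.
  by apply/fpsP => -[|n] /=; rewrite ?sub0r ?oppr0.
rewrite DsE t2E; have FD := denominator_path.
rewrite fps_constB1 in dH H; move: FD FE LE dH; move: (ddT Et) => dEt.
move: Et Fs Vs Xs (fps_const T) Ls H => e F V X S L <- FD FE LE dH.
rewrite 2!mulrBl FD.
have FV : (1 - S * V) * (1 + S * F) = 1.
  transitivity (1 + S * (F - S * (F * V)) - S * V); first by ring.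
  by rewrite {1}FE; ring.
transitivity (e * (1 - S) * V - e * (1 - S) * S * X * ((1 - S * V) * (1 + S * F))
   - (1 - S - S * ((1 - S) * V)) * (L * e)); first by ring.
rewrite FV LE.
transitivity (e * V - dEt - S * (e * V + (1 - S) * e * X - (1 + (1 - S) * V) * dEt)).
  by ring.
(* Up to sign, this factor is the derivative of [exp_cut], whose right-hand side [E] is free of
   $t$. *)
rewrite [X in S * X](_ : _ = 0); first by ring.
by rewrite -[RHS]oppr0 -[X in _ = - X]dH; ring.
Qed.
End Numerators.

Lemma subr1_qX_neq0 n : 1 - q ^+ n.+1 != 0.
Proof.
rewrite /q -tofracXn -tofrac1 -tofracB tofrac_eq0 -opprB oppr_eq0.
by rewrite -size_poly_gt0 size_XnsubC.
Qed.

Local Notation qP := (q%:P : {poly Qq}).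
Local Notation cP := ((1 - q)%:P : {poly Qq}).
Local Notation qU := (subr1_polyCX_unit subr1_qX_neq0).

Lemma exp_qE : exp_q = exp_series qP cP.
Proof.
apply/fpsP => n; rewrite (coef_expE subr1_qX_neq0).
by rewrite -[LHS]/((qfact n)^-1 *: 1) -mul_polyC mulr1.
Qed.

Lemma AltE_lam n : Alt n.+1 = qpoch qP n.+1 *
  (path_value qP t n
   - qlam qP (iota 0 n.+1) (fun f => (f 0 < f n)%N%:R * path_weight (free_edge t) 0 n f)
   - t ^+ n * (1 - qP ^+ n.+1)^-1).
Proof.
rewrite AltE (lam_perm_words qU (sum_tdes_lt t n)).
congr (_ * _); rewrite -(lam_const qU) -lamZ.
rewrite -[- qlam _ _ _]mulN1r -[X in _ + X]mulN1r -!lamZ -!lamD; apply: eq_lam => f.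
rewrite [(f n <= f 0)%N]leqNgt; move: (path_weight _ _ _ _) (t ^+ n * _) => a b.
by case: (_ < _)%N => /=; ring.
Qed.

Lemma sum_perm_words_lam n : \sum_(w <- perm_words n.+1) qP ^+ gap_maj w * tdes t n w
  = qpoch qP n.+1 * path_value qP t n.
Proof.
apply: (lam_perm_words (P := xpredT) qU) => f.
by rewrite -sum_tdes; apply: eq_bigl => w; rewrite andbT.
Qed.

Lemma qegf1E (F G : nat -> {poly Qq}) : (forall n, F n.+1 = qpoch qP n.+1 * G n) ->
  qegf 1 F = egf_pos cP G.
Proof.
move=> FG; apply/fpsP => -[|n] //.
rewrite -[LHS]/((qfact n.+1)^-1 *: F n.+1) -[RHS]/(cP ^+ n.+1 * G n).
rewrite -mul_polyC (bracket_prodV subr1_qX_neq0) FG mulrA mulrVK //.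
by rewrite rpred_prod // => i _; exact: qU.
Qed.

Local Notation Et := (fps_dilate t exp_q).
Local Notation D := (Et - fps_const t * exp_q).

Lemma qegf_Alt :
  qegf 1 Alt * D = fps_const (1 - t) * ddt (qegf 2 (fun i => bracket i t)).
Proof.
rewrite (qegf1E AltE_lam) exp_qE (denominator_alt subr1_qX_neq0).
by rewrite -(numeratorE subr1_qX_neq0).
Qed.

(** By [AtildeE] the series is $F$ minus $1-t$ times the first one. Times [D], this is
    $(1-t)E_tV-(1-t)(E_tV-\partial_tE_t)$, where the products with $V$ cancel. *)
Lemma qegf_Atilde : qegf 1 Atilde * D = fps_const (1 - t) * ddt Et.
Proof.
have -> : qegf 1 Atilde = egf_pos cP (path_value qP t) - fps_const (1 - t) * qegf 1 Alt.
  pose A n := \sum_(w <- perm_words n) qP ^+ gap_maj w * tdes t n.-1 w.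
  rewrite -(@qegf1E A _ sum_perm_words_lam); apply/fpsP => n.
  rewrite coef_fpsD coef_fpsN coef_fps_constM; case: n => [|n].
    by rewrite -[LHS]/(0 : {poly Qq}) -[RHS]/((0 : {poly Qq}) - (1 - t) * 0) mulr0 subr0.
  rewrite -[LHS]/((qfact n.+1)^-1 *: Atilde n.+1) AtildeE scalerBr scalerAr //.
have H := exp_cut t cP qU; rewrite -exp_qE in H.
rewrite mulrBl -mulrA qegf_Alt exp_qE (denominator_path subr1_qX_neq0) -exp_qE.
have -> : fps_const (1 - t) * ddt (qegf 2 (fun i => bracket i t))
    = Et * egf_pos cP (cut_value qP t) - ddt Et.
  by rewrite exp_qE -(numeratorE subr1_qX_neq0).
rewrite -[X in X - _ - _]H; move: (fps_const (1 - t)) (ddt Et) => S d; ring.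
Qed.

Lemma toQqtM f g : toQqt (f * g) = toQqt f * toQqt g.
Proof.
apply/fpsP => n; rewrite coef_fpsM -[LHS]/(tofrac (fcoef (f * g) n)) coef_fpsM rmorph_sum.
by apply: eq_bigr => i _; rewrite rmorphM.
Qed.

Lemma toQqt_denominator_unit : toQqt D \is a GRing.unit.
Proof.
rewrite fps_unitE unitfE tofrac_eq0.
rewrite (_ : fcoef D 0 = 1 - t) ?subr1_polyX_neq0 //.
rewrite coef_fpsD coef_fpsN coef_fps_constM -[fcoef Et 0]/(1 * fcoef exp_q 0) mul1r.
rewrite (_ : fcoef exp_q 0 = 1) ?mulr1 //.
by rewrite -[LHS]/((qfact 0)^-1 *: 1) /qfact big_ord0 invr1 scale1r.
Qed.

Theorem theorem6p1 :
  toQqt (qegf 1 Alt)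
    = toQqt (fps_const (1 - t) * ddt (qegf 2 (fun i => bracket i t)))
      / toQqt (fps_dilate t exp_q - fps_const t * exp_q)
  /\
  toQqt (qegf 1 Atilde)
    = toQqt (fps_const (1 - t) * ddt (fps_dilate t exp_q))
      / toQqt (fps_dilate t exp_q - fps_const t * exp_q).
Proof.
by split; apply: (canRL (mulrK toQqt_denominator_unit)); rewrite -toQqtM;
  [rewrite qegf_Alt | rewrite qegf_Atilde].
Qed.
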